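(* The primary and dual discrete nabla operators satisfy the following discrete analogue of the Schwarz theorem. Let $\tilde Z_h=\sum_q\psi_q Z_q\in\mathcal{W}_h^{N+1}$ be any scalar discrete field with degrees of freedom $Z_q\in\mathbb{R}$, and let $p$ be any index of a basis function $\psi_p$ for which the boundary contributions vanish, i.e. $\int_{\partial\Omega}\psi_p\,\phi_c\,\mathbf{n}\,dS=0$ for all $c$. Then for all $j,k\in\{1,\dots,d\}$, $$(\tilde\partial_j)_p^c\,(\partial_k)_c^q\, Z_q = (\tilde\partial_k)_p^c\,(\partial_j)_c^q\, Z_q$$ (summation over the repeated indices $c$ and $q$).
   Context: $\Omega\subset\mathbb{R}^d$, $d\in\{2,3\}$, is a domain with polyhedral boundary, partitioned by a conformal mesh into finitely many simplices $T_k$. $N\ge 0$ is an integer. $\mathcal{U}_h^N$ is the (scalar) discontinuous Galerkin space of functions whose restriction to each $T_k$ is a polynomial of degree (at most) $N$, with no continuity across elements; $(\phi_c)_c$ is a basis of it, each $\phi_c$ being supported in one element. $\mathcal{W}_h^{N+1}$ is the (scalar) space of globally continuous functions whose restriction to each $T_k$ is a polynomial of degree (at most) $N+1$; $(\psi_p)_p$ is its nodal Lagrange basis. All integrals are exact. Define $$K_{cpm}=\int_\Omega\phi_c\,\partial_m\psi_p\,d\mathbf{x},\qquad D_{ac}=\int_\Omega\phi_a\phi_c\,d\mathbf{x},$$ (derivatives of $\psi_p$ taken elementwise). The discrete primary nabla operator is $(\partial_m)_c^p=\sum_a D_{ca}^{-1}K_{apm}$, where $D^{-1}_{ca}$ are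 the entries of the inverse of the matrix $(D_{ac})$; the discrete dual nabla operator is $(\tilde\partial_m)_p^c=-K_{cpm}$. Boundary convention: boundary conditions are assumed to be such that boundary contributions on $\partial\Omega$ in the integration by parts against $\psi_p$ can be dropped. This is the case for instance if $\psi_p$ vanishes on $\partial\Omega$, or for periodic boundary conditions, where opposite boundary faces are identified conformally, all faces are interior faces, and $\partial\Omega$ is empty. *)

(* Defs.v *)
From HB Require Import structures.
From mathcomp Require Import all_boot all_order all_algebra.
From mathcomp Require Import all_classical all_reals all_analysis.
(* The notations of mpoly clash with those of the analysis library. *)
From mathcomp Require mpoly.
Import (canonicals, coercions) mpoly.

Set Implicit Arguments.
Unset Strict Implicit.
Unset Printing Implicit Defensive.

Import Order.TTheory GRing.Theory Num.Theory.
Import numFieldNormedType.Exports.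

Local Open Scope classical_set_scope.
Local Open Scope ring_scope.

Section Lebesgue.
Variable R : realType.
Local Notation RR := (measurableTypeR R).

Definition tcons n (p : RR * n.-tuple RR) : n.+1.-tuple RR :=
  [tuple of p.1 :: p.2].

Lemma measurable_tcons n : measurable_fun [set: RR * n.-tuple RR] (@tcons n).
Proof. exact: measurable_cons. Qed.

(* R^n.+1 carries the product of the measures of R and R^n. *)
Definition leb_step n (mu : {measure set (n.-tuple RR) -> \bar R}) :
    set (n.+1.-tuple RR) -> \bar R :=
  pushforward (@lebesgue_measure R \x^ mu)%E (@tcons n).

HB.instance Definition _ n (mu : {measure set (n.-tuple RR) -> \bar R}) :=
  Measure.copy (leb_step mu)
    (measure_function_pushforward__canonical__measure_function_Measure
      (@lebesgue_measure R \x^ mu)%E (@measurable_tcons n)).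

Fixpoint leb n : {measure set (n.-tuple RR) -> \bar R} :=
  if n is n'.+1 then leb_step (leb n') else \d_ ([tuple] : 0.-tuple RR).

Lemma leb_box n (A : 'I_n -> set RR) :
  (forall i, measurable (A i)) ->
  leb n [set t | forall i, A i (tnth t i)] =
  (\big[mule/1%E]_(i < n) lebesgue_measure (A i))%E.
Proof.
elim: n A => [|n IH] A mA.
  rewrite big_ord0 /= /dirac indicE mem_set //; by case.
rewrite big_ord_recl -IH; last by move=> i; exact: mA.
rewrite /= /leb_step /pushforward -product_measure2E; first last.
- rewrite (_ : mkset _ = \bigcap_(i in [set: 'I_n]) ((fun t => tnth t i) @^-1` A (lift ord0 i))).
    apply: fin_bigcap_measurable => // i _.
    by rewrite -[X in measurable X]setTI; apply: measurable_tnth.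
  by apply/seteqP; split => t /= h; [move=> i _; exact: h | move=> i; exact: h].
- exact: mA.
congr ((_ \x^ _)%E _); apply/seteqP; split => -[x t] /=.
  move=> h; split; first by have := h ord0.
  by move=> i; have := h (lift ord0 i); rewrite tnthS.
case=> hx ht i; case: (unliftP ord0 i) => [j ->|->//]; by rewrite tnthS; exact: ht.
Qed.

Definition rV_of_tuple n (t : n.-tuple RR) : 'rV[R]_n := \row_i tnth t i.

Definition integral_rV n (A : set 'rV[R]_n) (f : 'rV[R]_n -> R) : R :=
  \int[leb n]_(t in @rV_of_tuple n @^-1` A) f (rV_of_tuple t).

End Lebesgue.

Section Simplices.
Variable R : realType.

Definition dotp n (x y : 'rV[R]_n) : R := \sum_i x 0 i * y 0 i.

Definition conv_hull n (V : set 'rV[R]_n) : set 'rV[R]_n :=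
  smallest (@convex_set R 'rV[R]_n) V.

Definition frontier n (A : set 'rV[R]_n) : set 'rV[R]_n :=
  closure A `\` interior A.

Definition edges m n (w : 'I_m.+1 -> 'rV[R]_n) : 'M[R]_(m, n) :=
  \matrix_(i, j) (w (lift ord0 i) - w ord0) 0 j.

Definition ref_simplex m : set 'rV[R]_m :=
  [set s | (forall j, 0 <= s 0 j) /\ \sum_j s 0 j <= 1].

(* Surface integral of f over the m-simplex of R^n with vertices w, in its
   affine parametrization by the reference simplex; the area element is the
   square root of the Gram determinant of the edges. *)
Definition surface_integral m n (w : 'I_m.+1 -> 'rV[R]_n)
    (f : 'rV[R]_n -> R) : R :=
  Num.sqrt (\det (edges w *m (edges w)^T)) *
  integral_rV (@ref_simplex m) (fun s => f (w ord0 + s *m edges w)).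

(* Face i of a simplex is the one opposite to vertex i. *)
Definition is_outward_normal n (v : 'I_n.+1 -> 'rV[R]_n) (i : 'I_n.+1)
    (nu : 'rV[R]_n) : Prop :=
  [/\ dotp nu nu = 1,
      forall j k, j != i -> k != i -> dotp nu (v j - v k) = 0
    & forall j, j != i -> dotp nu (v i - v j) < 0].

(* For a nondegenerate simplex there is exactly one such vector. *)
Definition outward_normal n (v : 'I_n.+1 -> 'rV[R]_n) (i : 'I_n.+1) :
  'rV[R]_n := get [set nu | is_outward_normal v i nu].

End Simplices.

(* The space dimension is d'.+1, so that faces have dimension d'; a face is a
   pair of an element and a local vertex, the face being opposite to it. *)
Section Mesh.
Variables (R : realType) (d' : nat) (K : finType).
Local Notation d := d'.+1.
Local Notation faces := (K * 'I_d.+1)%type.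

(* Periodic boundary conditions are encoded by an involution [twin] of the
   faces: the faces with twin f != f are the identified ones, and f is mapped
   onto twin f by the translation by shift f.  Without periodicity, twin is
   the identity. *)
Record mesh := Mesh {
  dom : set 'rV[R]_d ;
  vtx : K -> 'I_d.+1 -> 'rV[R]_d ;
  twin : faces -> faces ;
  shift : faces -> 'rV[R]_d }.

Variable M : mesh.

Definition elt (k : K) : set 'rV[R]_d := conv_hull (range (vtx M k)).

Definition face_vertices (f : faces) : set 'rV[R]_d :=
  [set vtx M f.1 i | i in [set i | i != f.2]].

Definition face (f : faces) : set 'rV[R]_d := conv_hull (face_vertices f).

Definition normal (f : faces) : 'rV[R]_d := outward_normal (vtx M f.1) f.2.

Definition on_frontier (f : faces) : Prop := face f `<=` frontier (dom M).

Record is_mesh : Prop := IsMesh {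
  dom_open : open (dom M) ;
  dom_connected : connected (dom M) ;
  dom_nonempty : dom M !=set0 ;
  vtx_nondegenerate : forall k, edges (vtx M k) \in unitmx ;
  elt_cover : closure (dom M) = \bigcup_k elt k ;
  elt_disjoint : forall k l, k != l ->
    interior (elt k) `&` interior (elt l) = set0 ;
  elt_conformal : forall k l,
    elt k `&` elt l = conv_hull (range (vtx M k) `&` range (vtx M l)) ;
  frontier_faces : frontier (dom M) = \bigcup_(f in on_frontier) face f ;
  twinK : involutive (twin M) ;
  twin_frontier : forall f, twin M f != f -> on_frontier f ;
  twin_shift : forall f, twin M f != f ->
    face_vertices (twin M f) = [set x + shift M f | x in face_vertices f] ;
  twin_opposite : forall f, twin M f != f ->
    normal (twin M f) = - normal f }.

(* Piecewise polynomials, given by their polynomial on each element. *)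
Definition broken := {ffun K -> mpoly.mpoly d R}.

Definition peval (q : mpoly.mpoly d R) (x : 'rV[R]_d) : R :=
  mpoly.meval (fun i => x 0 i) q.

(* msize is the total degree plus one. *)
Definition DG (N : nat) : set broken :=
  [set u | forall k, (mpoly.msize (u k) <= N.+1)%N].

(* The last condition is continuity across the identified faces. *)
Definition CG (N : nat) : set broken :=
  [set u | [/\ DG N u,
    exists f : 'rV[R]_d -> R, {within dom M, continuous f} /\
      forall k x, dom M x -> elt k x -> f x = peval (u k) x
  & forall f x, twin M f != f -> face f x ->
      peval (u (twin M f).1) (x + shift M f) = peval (u f.1) x]].

Definition is_basis (V : set broken) m (b : 'I_m -> broken) : Prop :=
  (forall i, V (b i)) /\
  forall u, V u -> exists! a : {ffun 'I_m -> R}, u = \sum_i a i *: b i.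

Definition DG_basis (N : nat) m (phi : 'I_m -> broken) : Prop :=
  is_basis (DG N) phi /\
  forall c, exists k, forall l, l != k -> phi c l = 0.

(* A node is a point of a given element, so that it also makes sense for the
   points identified by periodicity. *)
Definition CG_nodal_basis (N : nat) m (psi : 'I_m -> broken) : Prop :=
  is_basis (CG N) psi /\
  exists (loc : 'I_m -> K) (node : 'I_m -> 'rV[R]_d),
    (forall q, elt (loc q) (node q)) /\
    forall p q, peval (psi p (loc q)) (node q) = (p == q)%:R.

Definition broken_integral (u : broken) : R :=
  \sum_k integral_rV (elt k) (peval (u k)).

(* The integral over the boundary of v u n, the traces of u and v on a face
   being taken from the element of that face; identified faces are interior. *)
Definition boundary_integral (v u : broken) : 'rV[R]_d :=
  \sum_(f : faces | `[< on_frontier f >] && (twin M f == f))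
    surface_integral (fun i => vtx M f.1 (lift f.2 i))
      (fun x => peval (v f.1) x * peval (u f.1) x) *: normal f.

Section Nabla.
Variables (nc np : nat) (phi : 'I_nc -> broken) (psi : 'I_np -> broken).

Definition Kten (m : 'I_d) : 'M[R]_(nc, np) :=
  \matrix_(c, p) broken_integral
    [ffun k => phi c k * mpoly.mderiv m (psi p k)].

Definition Dmat : 'M[R]_nc :=
  \matrix_(a, c) broken_integral [ffun k => phi a k * phi c k].

Definition primary_nabla (m : 'I_d) (c : 'I_nc) (p : 'I_np) : R :=
  \sum_a invmx Dmat c a * Kten m a p.

Definition dual_nabla (m : 'I_d) (p : 'I_np) (c : 'I_nc) : R := - Kten m c p.

End Nabla.
End Mesh.

(* Main.v *)
Require Import Defs.
From HB Require Import structures.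
From mathcomp Require Import all_boot all_order all_fingroup all_algebra.
From mathcomp Require Import all_classical all_reals all_analysis.
From mathcomp Require Import measurable_realfun ring lra.
From mathcomp Require mpoly.
Import (canonicals, coercions) mpoly.
Import Order.TTheory GRing.Theory Num.Theory.
Import numFieldNormedType.Exports.

Set Implicit Arguments.
Unset Strict Implicit.
Unset Printing Implicit Defensive.

Local Open Scope classical_set_scope.
Local Open Scope ring_scope.

(* Since the k-th derivative of Z_h lies in the discontinuous space, inverting
   the mass matrix expands it exactly in the phi_c, and the double sum equals
   minus the integral of the product of the elementwise derivatives d_k Z_h and
   d_j psi_p. Mixed partial derivatives commute on each element, so
     d_k Z_h d_j psi_p - d_j Z_h d_k psi_p = d_j(psi_p d_k Z_h) - d_k(psi_p d_j Z_h),
   and the divergence theorem turns the difference of the two sides into a sum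
   over all faces of the integrals of psi_p times the derivative of Z_h in the
   direction n_j e_k - n_k e_j, which is tangential. On a face shared by two
   elements, or on a pair of identified faces, psi_p and the tangential
   derivatives of Z_h agree and the outward normals are opposite, so the two
   contributions cancel; on the other boundary faces they vanish by hypothesis.

   The divergence theorem on a simplex is reduced by an affine change of
   variables to the fundamental theorem of calculus along one edge of the
   reference simplex. *)

(** * Lebesgue measure and affine maps *)

(** A mesh is given only by vertices, a cover of the closure, disjoint interiors and conformity, so
    the pairing of the faces has to be derived: a neighbor across an inner face exists by the cover
    and conformity, while its uniqueness and the opposite normals come from the disjoint interiors.
    The single-valuedness of a field is available only at points of the open domain, and an inner
    face may touch the frontier. Traces are therefore compared on a short segment issuing from a
    relatively interior point of the face that lies in the domain, and a polynomial identity in one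
    variable carries the equality to the whole hyperplane of the face; there, lines in tangential
    directions give the derivatives as well. Finally, the two elements enumerate a common face in
    unrelated orders, so surface integrals must be shown to depend only on the set of vertices. *)

Section LebesgueTuples.
Variable R : realType.
Local Notation RR := (measurableTypeR R).
Local Notation lambda := (@lebesgue_measure R).

(* A named copy of leb, so that it can carry a sigma-finite structure. *)
Definition sigma_leb n : set (n.-tuple RR) -> \bar R := leb R n.

HB.instance Definition _ n := Measure.copy (@sigma_leb n) (leb R n).

Lemma sigma_leb_sigma_finite n : sigma_finite setT (@sigma_leb n).
Proof.
exists (fun k => [set t | forall i, tnth t i \in `[- k%:R, k%:R]%R]).
  apply/esym; rewrite -subTset => t _.
  have [k _ hk] : (\bigcup_k [set t : n.-tuple RR | forall i, `|tnth t i| <= k%:R]) t.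
    exists (Num.truncn (\sum_i `|tnth t i|)).+1 => //= i.
    apply: le_trans (ltW (truncnS_gt _)).
    by rewrite (bigD1 i)//= lerDl; apply: sumr_ge0.
  exists k => //= i; rewrite in_itv/= -ler_norml; exact: hk.
move=> k; split.
  rewrite (_ : mkset _ = \bigcap_(i in [set: 'I_n]) ((fun t => tnth t i) @^-1` `[- k%:R, k%:R])).
    apply: fin_bigcap_measurable => // i _.
    by rewrite -[X in measurable X]setTI; apply: measurable_tnth.
  by apply/seteqP; split => t /= h; [move=> i _; exact: h | move=> i; exact: h].
rewrite /sigma_leb (leb_box (A := fun=> `[- k%:R, k%:R]%classic))//.
rewrite lebesgue_measure_itv /= -EFinD.
elim/big_rec: _ => [|i x _ hx]; first exact: ltry.
case: ifP => _; last by rewrite mul0e.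
by rewrite lte_mul_pinfty// lee_fin opprK addr_ge0.
Qed.

HB.instance Definition _ n :=
  Measure_isSigmaFinite.Build _ _ _ (@sigma_leb n) (@sigma_leb_sigma_finite n).

Local Open Scope ereal_scope.


Definition tint n (F : n.-tuple RR -> \bar R) : \bar R :=
  \int[@sigma_leb n]_t F t.

Lemma tintS_product2 n (F : n.+1.-tuple RR -> \bar R) :
  measurable_fun setT F -> (forall t, 0 <= F t) ->
  tint F = \int[lambda \x^ (@sigma_leb n)]_p F (tcons p).
Proof.
move=> mF F0.
by rewrite /= /leb_step /tint (ge0_integral_pushforward (measurable_tcons (n:=n))).
Qed.

(** The Tonelli and Fubini theorems used below are stated for [\x], whereas [leb_step] uses [\x^];
    the two products agree on rectangles, hence everywhere by uniqueness of the product measure. *)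
Lemma tintS_product1 n (F : n.+1.-tuple RR -> \bar R) :
  measurable_fun setT F -> (forall t, 0 <= F t) ->
  tint F = \int[lambda \x (@sigma_leb n)]_p F (tcons p).
Proof.
move=> mF F0; rewrite tintS_product2//; apply: eq_measure_integral => A mA _.
apply/esym; apply: product_measure_unique => // B C mB mC.
exact: product_measure2E.
Qed.

(** Both orders of integration are needed: the head coordinate goes innermost for maps that stretch
    it by an amount and translate it by a function of the tail, and outermost for maps that move the
    tail depending on the head. *)
Lemma tonelli_head_in n (F : n.+1.-tuple RR -> \bar R) :
  measurable_fun setT F -> (forall t, 0 <= F t) ->
  tint F = tint (fun t => \int[lambda]_x F (tcons (x, t))).
Proof.
move=> mF F0; rewrite tintS_product1//.
rewrite (fubini_tonelli2 (F \o @tcons R n))//.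
  by apply: measurableT_comp => //; exact: measurable_tcons.
by move=> x; exact: F0.
Qed.

Lemma tonelli_head_out n (F : n.+1.-tuple RR -> \bar R) :
  measurable_fun setT F -> (forall t, 0 <= F t) ->
  tint F = \int[lambda]_x tint (fun t => F (tcons (x, t))).
Proof.
move=> mF F0; rewrite tintS_product1//.
rewrite (fubini_tonelli1 (F \o @tcons R n))//.
  by apply: measurableT_comp => //; exact: measurable_tcons.
by move=> x; exact: F0.
Qed.

Lemma measurable_tcons_head n (F : n.+1.-tuple RR -> \bar R) :
  measurable_fun setT F -> (forall t, 0 <= F t) ->
  measurable_fun setT (fun t : n.-tuple RR => \int[lambda]_x F (tcons (x, t))).
Proof.
move=> mF F0.
apply: (@measurable_fun_fubini_tonelli_G _ _ _ _ _ lambda (F \o @tcons R n)) => //.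
  by apply: measurableT_comp => //; exact: measurable_tcons.
by move=> *; exact: F0.
Qed.

(** Lebesgue measure is determined by its values on the intervals []p, q]], and the pushforward
    under the affine map, rescaled by [|a|], has the right ones. *)
Lemma lebesgue_affine (a b : R) (F : RR -> \bar R) : a != 0%R ->
  measurable_fun setT F -> (forall t, 0 <= F t) ->
  \int[lambda]_x F (a * x + b)%R = `|a|^-1%:E * \int[lambda]_x F x.
Proof.
move=> a0 mF F0.
have mg : measurable_fun setT (fun x : RR => (a * x + b)%R : RR).
  apply: measurable_funD => //; exact: measurable_funM.
have na0 : (0 < `|a|)%R by rewrite normr_gt0.
have nn : (0 <= `|a|)%R by [].
have nn' : (0 <= `|a|^-1)%R by rewrite invr_ge0.
transitivity (\int[mscale (NngNum nn') lambda]_x F x); last first.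
  by rewrite ge0_integral_mscale.
rewrite -[LHS](@ge0_integral_pushforward _ _ _ _ _ _ mg lambda setT F)//.
apply: eq_measure_integral => A mA _.
pose g x : RR := (a * x + b)%R.
pose pm : {measure set RR -> \bar R} :=
  measure_function_pushforward__canonical__measure_function_Measure lambda mg.
suff E : lambda A = mscale (NngNum nn) pm A.
  transitivity (`|a|^-1%:E * lambda A); last by [].
  by rewrite E /mscale/= muleA -EFinM mulVf ?gt_eqF// mul1e.
apply: lebesgue_measure_unique => // _ [[p q] _ <-].
have [pq|pq] := leP q p.
  by rewrite set_itv_ge ?bnd_simp -?leNgt// !measure0.
transitivity (`|a|%:E * lambda (g @^-1` `]p, q])); last by [].
rewrite lebesgue_measure_itv/= lte_fin pq.
have [ap|an] := ltP 0%R a.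
  have -> : g @^-1` `]p, q] = `]((p - b) / a)%R, ((q - b) / a)%R]%classic.
    apply/seteqP; split => x /=; rewrite !in_itv/= /g.
      by move=> /andP[h1 h2]; rewrite ltr_pdivrMr// ler_pdivlMr//; apply/andP; split; lra.
    rewrite ltr_pdivrMr// ler_pdivlMr// => /andP[h1 h2].
    by apply/andP; split; lra.
  rewrite lebesgue_measure_itv/= lte_fin ltr_pM2r ?invr_gt0// ltrD2r pq.
  rewrite -!EFinD -EFinM gtr0_norm//; congr (_%:E); by field.
(* A decreasing map exchanges the open and the closed end, which leaves the length unchanged. *)
have {}an : (a < 0)%R by rewrite lt_neqAle a0.
have -> : g @^-1` `]p, q] = `[((q - b) / a)%R, ((p - b) / a)%R[%classic.
  apply/seteqP; split => x /=; rewrite !in_itv/= /g.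
    by move=> /andP[h1 h2]; rewrite ltr_ndivlMr// ler_ndivrMr//; apply/andP; split; lra.
  rewrite ltr_ndivlMr// ler_ndivrMr// => /andP[h1 h2].
  by apply/andP; split; lra.
rewrite lebesgue_measure_itv/= lte_fin ltr_nM2r ?invr_lt0// ltrD2r pq.
rewrite -!EFinD -EFinM ltr0_norm//; congr (_%:E); by field.
Qed.

End LebesgueTuples.

Section AffineChange.
Variable R : realType.
Local Notation RR := (measurableTypeR R).
Local Notation lambda := (@lebesgue_measure R).

Definition aff n (A : 'M[R]_n) (b : 'rV[R]_n) (t : n.-tuple RR) : n.-tuple RR :=
  [tuple (rV_of_tuple t *m A + b) 0 i | i < n].

Lemma rV_of_aff n (A : 'M[R]_n) b (t : n.-tuple RR) :
  rV_of_tuple (aff A b t) = rV_of_tuple t *m A + b.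
Proof. by apply/rowP => i; rewrite mxE tnth_mktuple. Qed.

Lemma rV_of_tuple_inj n : injective (@rV_of_tuple R n).
Proof.
move=> s t /rowP h; apply: eq_from_tnth => i.
by have := h i; rewrite !mxE.
Qed.

Lemma rV_of_tcons n (p : RR * n.-tuple RR) :
  rV_of_tuple (tcons p) = row_mx (p.1)%:M (rV_of_tuple p.2) :> 'rV_(1 + n).
Proof.
apply/rowP => i; rewrite !mxE; case: (splitP i) => [j|j] ij.
  by rewrite mxE (_ : i = ord0) ?ord1//; apply: ord_inj; rewrite ij ord1.
by rewrite mxE (_ : i = lift ord0 j) ?tnthS//; apply: ord_inj; rewrite ij.
Qed.

Lemma rV_of_tcons_block n (p : RR * n.-tuple RR) a b c d :
  (rV_of_tuple (tcons p) : 'rV_(1 + n)) *m (block_mx a b c d : 'M[R]_(1 + n)) =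
  row_mx ((p.1)%:M *m a + rV_of_tuple p.2 *m c)
         ((p.1)%:M *m b + rV_of_tuple p.2 *m d).
Proof. by rewrite rV_of_tcons mul_row_block. Qed.

Lemma measurable_aff n (A : 'M[R]_n) b :
  measurable_fun setT (aff A b : n.-tuple RR -> n.-tuple RR).
Proof.
apply/measurable_fun_tnthP => i.
rewrite (_ : _ \o _ = fun t : n.-tuple RR =>
   (\sum_j tnth t j * A j i) + b 0 i); last first.
  apply/funext => t /=; rewrite tnth_mktuple !mxE; congr (_ + _).
  by apply: eq_bigr => j _; rewrite mxE.
apply: measurable_funD => //; apply: measurable_sum => j.
by apply: measurable_funM => //; exact: measurable_tnth.
Qed.

(** Change of variables with constant inverse Jacobian [c], phrased for nonnegative functions so
    that Tonelli applies and the property composes. *)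
Definition scales n (c : R) (g : n.-tuple RR -> n.-tuple RR) :=
  measurable_fun setT g /\
  forall F : n.-tuple RR -> \bar R, measurable_fun setT F ->
    (forall t, 0 <= F t)%E -> tint (fun t => F (g t)) = (c%:E * tint F)%E.

Lemma scales_comp n c d (g h : n.-tuple RR -> n.-tuple RR) :
  scales c g -> scales d h -> scales (c * d) (h \o g).
Proof.
move=> [mg hg] [mh hh]; split; first exact: measurableT_comp.
move=> F mF F0 /=; rewrite (hg (F \o h))//; last by move=> t; exact: F0.
  by rewrite (hh F)// muleA -EFinM.
exact: measurableT_comp.
Qed.

Definition ttail n (t : n.+1.-tuple RR) : n.-tuple RR := [tuple of behead t].

Lemma measurable_thead n :
  measurable_fun setT (fun t : n.+1.-tuple RR => thead t).
Proof. exact: (measurable_tnth ord0). Qed.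

Lemma measurable_ttail n : measurable_fun setT (@ttail n).
Proof. exact: measurable_behead. Qed.

Lemma ttail_tcons n (p : RR * n.-tuple RR) : ttail (tcons p) = p.2.
Proof. exact: val_inj. Qed.

Lemma thead_tcons n (p : RR * n.-tuple RR) : thead (tcons p) = p.1.
Proof. by []. Qed.

Lemma measurable_tcons_pair n (f : n.+1.-tuple RR -> RR)
    (g : n.+1.-tuple RR -> n.-tuple RR) :
  measurable_fun setT f -> measurable_fun setT g ->
  measurable_fun setT (fun t => tcons (f t, g t)).
Proof. by move=> mf mg; exact: measurable_cons. Qed.

(** For a fixed tail the inner integral over the head is a one-dimensional affine substitution; what
    remains is a function of [g] of the tail. *)
Lemma scales_cons n (c a : R) (l : n.-tuple RR -> RR) g :
  a != 0 -> measurable_fun setT l -> scales c g ->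
  scales (`|a|^-1 * c)
    (fun t => tcons (a * thead t + l (ttail t), g (ttail t))).
Proof.
move=> a0 ml [mg hg].
have mG : measurable_fun setT (fun t : n.+1.-tuple RR =>
    tcons (a * thead t + l (ttail t), g (ttail t))).
  apply: measurable_tcons_pair.
    apply: measurable_funD.
      by apply: measurable_funM => //; exact: measurable_thead.
    by apply: measurableT_comp => //; exact: measurable_ttail.
  by apply: measurableT_comp => //; exact: measurable_ttail.
split=> // F mF F0.
rewrite tonelli_head_in//; last exact: measurableT_comp.
transitivity (tint (fun t => (`|a|^-1)%:E * (fun s : n.-tuple RR =>
    \int[lambda]_x F (tcons (x, s))) (g t)))%E.
  apply: eq_integral => t _.
  under eq_integral do rewrite thead_tcons ttail_tcons /=.
  rewrite (lebesgue_affine (l t) (F := fun x => F (tcons (x, g t))))//.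
  apply: measurableT_comp => //.
  rewrite (_ : (fun _ => _) = @tcons R n \o (fun x => (x, g t)))//.
  apply: measurableT_comp; first exact: measurable_tcons.
  exact: measurable_pair2.
have mH := measurable_tcons_head mF F0.
rewrite /tint ge0_integralZl//; first last.
- by move=> t _; apply: integral_ge0.
- exact: (measurableT_comp mH mg).
rewrite EFinM -muleA; congr (_ * _)%E.
rewrite -/(tint F) tonelli_head_in// -(hg _ mH)// => t.
by apply: integral_ge0.
Qed.

(** With the head fixed in the outer integral, each [h x] preserves the inner one. *)
Lemma scales_shear n (h : RR -> n.-tuple RR -> n.-tuple RR) :
  measurable_fun setT (fun t : n.+1.-tuple RR => h (thead t) (ttail t)) ->
  (forall x, scales 1 (h x)) ->
  scales 1 (fun t => tcons (thead t, h (thead t) (ttail t))).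
Proof.
move=> mh sh.
have mG : measurable_fun setT (fun t : n.+1.-tuple RR =>
    tcons (thead t, h (thead t) (ttail t))).
  by apply: measurable_tcons_pair => //; exact: measurable_thead.
split=> // F mF F0.
rewrite !tonelli_head_out//; last exact: measurableT_comp.
rewrite mul1e; apply: eq_integral => x _.
transitivity (tint (fun t => F (tcons (x, h x t)))).
  by apply: eq_integral => t _; rewrite thead_tcons ttail_tcons.
have [_ hx] := sh x.
rewrite (hx (fun t => F (tcons (x, t)))) ?mul1e//.
apply: measurableT_comp => //.
rewrite (_ : (fun _ => _) = @tcons R n \o (fun t => (x, t)))//.
apply: measurableT_comp; first exact: measurable_tcons.
exact: measurable_pair1.
Qed.

Lemma scales_tuple0 (g : 0.-tuple RR -> 0.-tuple RR) : scales 1 g.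
Proof.
have -> : g = id by apply/funext => t; rewrite tuple0 [RHS]tuple0.
by split=> [|F mF F0]; [exact: measurable_id | rewrite mul1e].
Qed.

Lemma scales_translation n (b : 'rV[R]_n) : scales 1 (aff 1%:M b).
Proof.
elim: n b => [|n IH] b; first exact: scales_tuple0.
have := scales_cons (oner_neq0 R) (@measurable_cst _ _ (n.-tuple RR) RR setT (b 0 ord0))
  (IH (rsubmx (b : 'rV_(1 + n)))).
rewrite normr1 invr1 mul1r; congr (scales _ _); apply/funext => t.
apply: rV_of_tuple_inj; rewrite rV_of_aff rV_of_tcons/= rV_of_aff !mulmx1.
have tE : t = tcons (thead t, ttail t) by apply: val_inj; case/tupleP: t.
rewrite [in RHS]tE rV_of_tcons/= mul1r.
rewrite -[RHS](congr1 (fun b' => _ + b') (hsubmxK (b : 'rV_(1 + n)))) add_row_mx.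
have -> // : (thead t + b 0 ord0)%:M = (thead t)%:M + lsubmx (b : 'rV_(1 + n)).
rewrite raddfD/=; congr (_ + _); rewrite [RHS]mx11_scalar mxE.
by congr (b _ _)%:M; exact: val_inj.
Qed.

(* Block elimination factors a matrix with nonzero pivot into a block triangular
   map and a shear; a further shear makes the pivot nonzero. *)
Lemma scales_aff n (A : 'M[R]_n) b : A \in unitmx ->
  scales `|\det A|^-1 (aff A b).
Proof.
move=> uA.
suff sA : scales `|\det A|^-1 (aff A 0).
  have := scales_comp sA (scales_translation b); rewrite mulr1.
  congr (scales _ _); apply/funext => t; apply: rV_of_tuple_inj.
  by rewrite /= !rV_of_aff mulmx1 addr0.
elim: n A {b} uA => [|n IH] A uA.
  by rewrite det_mx00 normr1 invr1; exact: scales_tuple0.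
have tE (t : n.+1.-tuple RR) : t = tcons (thead t, ttail t).
  by apply: val_inj; case/tupleP: t.
pose Sh (u : 'rV[R]_n) : 'M[R]_(1 + n) := block_mx 1 u 0 1%:M.
have shear (u : 'rV[R]_n) : scales 1 (aff (Sh u) 0).
  have := @scales_shear n (fun x => aff 1%:M (x *: u)) _ (fun x => scales_translation _).
  set P := measurable_fun _ _ => /(_ _)/wrap[].
    rewrite /P; apply/measurable_fun_tnthP => i.
    rewrite (_ : _ \o _ = fun t => tnth (ttail t) i + thead t * u 0 i).
      apply: measurable_funD; last by apply: measurable_funM => //; exact: measurable_thead.
      by apply: measurableT_comp (measurable_tnth i) (@measurable_ttail n).
    by apply/funext => t /=; rewrite tnth_mktuple mulmx1 !mxE.
  congr (scales _ _); apply/funext => t; apply: rV_of_tuple_inj.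
  rewrite rV_of_aff rV_of_tcons/= rV_of_aff mulmx1 addr0 [in RHS](tE t).
  rewrite rV_of_tcons_block/= !mulmx0 !mulmx1 mul_scalar_mx addr0.
  by rewrite addrC.
have pivot (A' : 'M[R]_(1 + n)) : A' \in unitmx -> A' 0 0 != 0 ->
    scales `|\det A'|^-1 (aff A' 0).
  move=> uA' a0.
  set a := A' 0 0 in a0.
  pose l := dlsubmx A'; pose u := ursubmx A'.
  pose B := drsubmx A' - l *m (a^-1 *: u).
  (* Elimination with pivot [a]: [B] is the Schur complement, and it is invertible because the
     determinant of [A'] is [a * \det B]. *)
  have E : A' = block_mx a%:M 0 l B *m block_mx 1 (a^-1 *: u) 0 1%:M.
    rewrite mulmx_block !mulmx0 !mul0mx !mulmx1 !addr0 mul_scalar_mx scalerA.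
    rewrite mulfV// scale1r /B addrC subrK -[LHS]submxK; congr block_mx.
    by rewrite [LHS]mx11_scalar !mxE; congr (A' _ _)%:M; apply: val_inj.
  have dE : \det A' = a * \det B.
    by rewrite E det_mulmx det_lblock det_ublock !det1 !mulr1 det_scalar1.
  have uB : B \in unitmx.
    by move: uA'; rewrite !unitmxE dE unitrM => /andP[].
  have s1 := @scales_cons n _ a (fun t => (rV_of_tuple t *m l) 0 0) _ a0 _ (IH B uB).
  have {}s1 := s1 _.
  have := scales_comp (s1 _) (shear (a^-1 *: u)).
  rewrite dE normrM invfM mulr1; set P := measurable_fun _ _ => /(_ _)/wrap[].
    rewrite /P (_ : (fun _ => _) = fun t : n.-tuple RR => \sum_j tnth t j * l j 0).
      apply: measurable_sum => j.
      by apply: measurable_funM => //; exact: measurable_tnth.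
    by apply/funext => t; rewrite mxE; apply: eq_bigr => j _; rewrite mxE.
  congr (scales _ _); apply/funext => t; apply: rV_of_tuple_inj.
  rewrite /= !rV_of_aff !addr0 [in RHS](tE t) [in RHS]E mulmxA.
  congr (_ *m _).
  rewrite rV_of_tcons_block rV_of_tcons/= mulmx0 add0r rV_of_aff addr0.
  suff -> : (a * thead t + (rV_of_tuple (ttail t) *m l) 0 0)%:M =
    (thead t)%:M *m a%:M + rV_of_tuple (ttail t) *m l by [].
  rewrite -scalar_mxM raddfD/= mulrC; congr (_ + _).
  by rewrite [RHS]mx11_scalar.
have [a0|a0] := eqVneq (A 0 0) 0; last exact: pivot.
have [i Ai] : exists i : 'I_n, (A : 'M[R]_(1 + n)) (rshift 1 i) 0 != 0.
  apply/existsP; apply: contraT; rewrite negb_exists => /forallP h.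
  suff : \det A = 0 by move: uA; rewrite unitmxE => /[swap] ->; rewrite unitr0.
  rewrite (expand_det_col _ 0) big1// => k _.
  suff -> : A k 0 = 0 by rewrite mul0r.
  case: (unliftP ord0 k) => [j ->|->//].
  have := h j; rewrite negbK => /eqP <-; congr (A _ _); exact: val_inj.
(* Left multiplication by [S 1] adds a row with nonzero first entry to row 0, which makes the pivot
   nonzero; the shear [S (-1)], applied beforehand, compensates for it. *)
pose S (c : R) : 'M[R]_(1 + n) := block_mx 1 (c *: delta_mx 0 i) 0 1%:M.
have SS : S (-1) *m S 1 = 1%:M.
  rewrite /S mulmx_block !mulmx0 !mul0mx !mulmx1 !mul1mx !addr0 add0r.
  by rewrite scaleN1r scale1r subrr -scalar_mx_block.
have dS c : \det (S c) = 1 by rewrite det_ublock !det1 mulr1.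
have dSA : \det (S 1 *m A) = \det A by rewrite det_mulmx dS mul1r.
have S0 j (z : 'I_(1 + n)) : z = 0 :> nat -> S 1 z (rshift 1 j) = (j == i)%:R.
  move=> z0; have -> : z = lshift n 0 by exact: ord_inj.
  by rewrite block_mxEur !mxE mul1r.
have pne : (S 1 *m A) 0 0 != 0.
  rewrite mxE big_split_ord/= big_ord1 (_ : lshift n 0 = 0) ?a0; last exact: val_inj.
  rewrite mulr0 add0r (bigD1 i)//= big1 => [|j ji]; first by rewrite addr0 S0// eqxx mul1r.
  by rewrite S0// (negbTE ji) mul0r.
have uSA : S 1 *m A \in unitmx by rewrite unitmx_mul uA unitmxE dS unitr1.
have := pivot _ uSA pne; rewrite dSA.
move=> s2; have := scales_comp (shear (-1 *: delta_mx 0 i)) s2; rewrite mul1r.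
congr (scales _ _); apply/funext => t; apply: rV_of_tuple_inj.
by rewrite /= !rV_of_aff !addr0 -mulmxA (mulmxA _ (S 1)) SS mul1mx.
Qed.

End AffineChange.

(** * Polynomial functions on the reference simplex *)

Section IntegralRV.
Variable R : realType.
Local Notation RR := (measurableTypeR R).
Local Notation lambda := (@lebesgue_measure R).

Lemma tintE n (F : n.-tuple RR -> \bar R) :
  tint F = (tint F^\+%E - tint F^\-%E)%E.
Proof. by rewrite /tint integralE. Qed.

Lemma gt0_muleBr (c : R) (x y : \bar R) : 0 < c -> (0 <= x)%E -> (0 <= y)%E ->
  (c%:E * (x - y) = c%:E * x - c%:E * y)%E.
Proof.
move=> c0; case: x y => [x||] [y||]//= _ _; rewrite ?gt0_muley ?gt0_muleNy//.
by rewrite -!EFinD -!EFinM mulrBr.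
Qed.

(** Positive and negative parts scale separately, and a positive factor distributes over their
    difference even when both are infinite. *)
Lemma tint_scales n c g (F : n.-tuple RR -> \bar R) : 0 < c -> scales c g ->
  measurable_fun setT F -> tint (fun t => F (g t)) = (c%:E * tint F)%E.
Proof.
move=> c0 [mg hg] mF.
rewrite tintE [in RHS]tintE gt0_muleBr//; try exact: integral_ge0.
have mp : measurable_fun setT F^\+%E by exact: measurable_funepos.
have mn : measurable_fun setT F^\-%E by exact: measurable_funeneg.
rewrite -(hg _ mp (funepos_ge0 F)) -(hg _ mn (funeneg_ge0 F)).
by rewrite -[(fun t => F (g t))]/(F \o g) funepos_comp funeneg_comp.
Qed.

Definition rv_integrand n (A : set 'rV[R]_n) (f : 'rV[R]_n -> R) :=
  ((fun t : n.-tuple RR => (f (rV_of_tuple t))%:E) \_ (@rV_of_tuple R n @^-1` A)).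

Lemma integral_rVE n (A : set 'rV[R]_n) f :
  integral_rV A f = fine (tint (rv_integrand A f)).
Proof. by rewrite /integral_rV /Rintegral integral_mkcond. Qed.

Lemma measurable_rv_integrand n (A : set 'rV[R]_n) (f : 'rV[R]_n -> R) :
  measurable (@rV_of_tuple R n @^-1` A) ->
  measurable_fun setT (fun t : n.-tuple RR => f (rV_of_tuple t)) ->
  measurable_fun setT (rv_integrand A f).
Proof.
move=> mA mf; apply/(measurable_restrictT _ mA).
by apply/measurable_EFinP; exact: measurable_funTS.
Qed.

Lemma integral_rV_affine n (E : 'M[R]_n) b (A : set 'rV[R]_n) (f : 'rV[R]_n -> R) :
  E \in unitmx -> measurable (@rV_of_tuple R n @^-1` A) ->
  measurable_fun setT (fun t : n.-tuple RR => f (rV_of_tuple t)) ->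
  integral_rV A f = `|\det E| *
    integral_rV [set s | A (b + s *m E)] (fun s => f (b + s *m E)).
Proof.
move=> uE mA mf; rewrite !integral_rVE.
have dE : 0 < `|\det E| by rewrite normr_gt0 -unitfE -unitmxE.
have dE' : 0 < `|\det E|^-1 by rewrite invr_gt0.
have -> : rv_integrand [set s | A (b + s *m E)] (fun s => f (b + s *m E)) =
    fun t => rv_integrand A f (aff E b t).
  apply/funext => t; rewrite /rv_integrand /patch/=.
  have -> : (t \in @rV_of_tuple R n @^-1` [set s | A (b + s *m E)]) =
            (aff E b t \in @rV_of_tuple R n @^-1` A).
    by apply/idP/idP; rewrite !inE/= rV_of_aff addrC.
  by rewrite rV_of_aff addrC.
rewrite (tint_scales dE' (scales_aff _ uE)); last exact: measurable_rv_integrand.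
(* [fine] sends both infinities to 0, so the identity persists for them. *)
case: (tint _) => [x||]/=; first by rewrite mulrA divff ?gt_eqF// mul1r.
  by rewrite gt0_muley// mulr0.
by rewrite gt0_muleNy// mulr0.
Qed.

Lemma fubini_head n (G : n.+1.-tuple RR -> \bar R) :
  measurable_fun setT G -> (tint (fun t => `|G t|) < +oo)%E ->
  tint G = tint (fun t => \int[lambda]_x G (tcons (x, t)))%E.
Proof.
move=> mG fG.
have mGt : measurable_fun setT (G \o @tcons R n).
  by apply: measurableT_comp => //; exact: measurable_tcons.
have iG : (lambda \x (@sigma_leb R n))%E.-integrable setT (G \o @tcons R n).
  apply/integrable21ltyP => //; rewrite tonelli_head_in in fG => //.
  exact: measurableT_comp.
transitivity (\int[lambda \x (@sigma_leb R n)]_p (G \o @tcons R n) p)%E; last first.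
  by rewrite -(integral21_prod_meas1 iG).
rewrite tintE !tintS_product1//.
- by rewrite [RHS]integralE (funepos_comp G (@tcons R n)) (funeneg_comp G (@tcons R n)).
- exact: measurable_funeneg.
- exact: measurable_funepos.
Qed.

(** A predicate on functions rather than on formal polynomials: it is stable under affine
    substitutions between spaces of different dimensions, and measurability, continuity and bounds
    follow by induction. *)
Inductive polyfun n : ('rV[R]_n -> R) -> Prop :=
| polyfun_cst c : polyfun (fun=> c)
| polyfun_coord i : polyfun (fun x => x 0 i)
| polyfunD f g : polyfun f -> polyfun g -> polyfun (fun x => f x + g x)
| polyfunM f g : polyfun f -> polyfun g -> polyfun (fun x => f x * g x).

Lemma polyfunZ n c (f : 'rV[R]_n -> R) : polyfun f -> polyfun (fun x => c * f x).
Proof. by apply: polyfunM; exact: polyfun_cst. Qed.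

Lemma polyfun_sum n (I : Type) (r : seq I) (f : I -> 'rV[R]_n -> R) :
  (forall i, polyfun (f i)) -> polyfun (fun x => \sum_(i <- r) f i x).
Proof.
move=> pf; elim: r => [|i r IH].
  under eq_fun do rewrite big_nil; exact: polyfun_cst.
under eq_fun do rewrite big_cons; exact: polyfunD.
Qed.

Lemma polyfun_affine n m (b : 'rV[R]_n) (E : 'M[R]_(m, n)) f :
  polyfun f -> polyfun (fun s => f (b + s *m E)).
Proof.
elim=> {f} [c|i|f g _ pf _ pg|f g _ pf _ pg].
- exact: polyfun_cst.
- under eq_fun do rewrite !mxE.
  apply: polyfunD; first exact: polyfun_cst.
  by apply: polyfun_sum => j; apply: polyfunM; [exact: polyfun_coord|exact: polyfun_cst].
- exact: polyfunD.
- exact: polyfunM.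
Qed.

Lemma polyfun_measurable n (f : 'rV[R]_n -> R) : polyfun f ->
  measurable_fun setT (fun t : n.-tuple RR => f (rV_of_tuple t)).
Proof.
elim=> {f} [c|i|f g _ pf _ pg|f g _ pf _ pg].
- exact: measurable_cst.
- by under eq_fun do rewrite mxE; exact: measurable_tnth.
- exact: measurable_funD.
- exact: measurable_funM.
Qed.

Lemma polyfun_bounded n (f : 'rV[R]_n -> R) : polyfun f ->
  exists2 B : R, 0 <= B & forall s : 'rV_n, (forall i, `|s 0 i| <= 1) -> `|f s| <= B.
Proof.
elim=> {f} [c|i|f g _ [B B0 pf] _ [C C0 pg]|f g _ [B B0 pf] _ [C C0 pg]].
- by exists `|c|.
- by exists 1 => // s; exact.
- exists (B + C) => [|s hs]; first exact: addr_ge0.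
  by rewrite (le_trans (ler_normD _ _))// lerD ?pf ?pg.
- exists (B * C) => [|s hs]; first exact: mulr_ge0.
  by rewrite normrM ler_pM ?pf ?pg.
Qed.

Lemma polyfun_continuous n (f : 'rV[R]_n -> R) : polyfun f -> continuous f.
Proof.
elim=> {f} [c|i|f g _ pf _ pg|f g _ pf _ pg] x.
- exact: cst_continuous.
- exact: coord_continuous.
- exact: (continuousD (pf x) (pg x)).
- exact: (continuousM (pf x) (pg x)).
Qed.

Lemma ref_simplex_le1 n (s : 'rV[R]_n) i : ref_simplex s -> `|s 0 i| <= 1.
Proof.
move=> [s0 s1]; rewrite ger0_norm//; apply: le_trans s1.
by rewrite (bigD1 i)//= lerDl; apply: sumr_ge0.
Qed.

Lemma measurable_ref_simplex n :
  measurable (@rV_of_tuple R n @^-1` (@ref_simplex R n)).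
Proof.
rewrite (_ : _ @^-1` _ = (\bigcap_(i in [set: 'I_n])
   ((fun t => rV_of_tuple t 0 i) @^-1` `[0, +oo[)) `&`
   ((fun t => \sum_j (rV_of_tuple t 0 j)) @^-1` `]-oo, 1])); last first.
  apply/seteqP; split => t /=.
    move=> [h1 h2]; split; last by rewrite /= in_itv.
    by move=> i _ /=; rewrite in_itv/= andbT.
  move=> [h1 h2]; split; last by move: h2; rewrite /= in_itv.
  by move=> j; have := h1 j Logic.I; rewrite /= in_itv/= andbT.
apply: measurableI.
  apply: fin_bigcap_measurable => // i _.
  rewrite -[X in measurable X]setTI.
  by apply: (polyfun_measurable (polyfun_coord i)).
rewrite -[X in measurable X]setTI.
by apply: (polyfun_measurable (polyfun_sum _ (@polyfun_coord n))).
Qed.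

Lemma ref_simplex_finite n :
  (@sigma_leb R n (@rV_of_tuple R n @^-1` (@ref_simplex R n)) < +oo)%E.
Proof.
pose box := [set t : n.-tuple RR | forall i, tnth t i \in `[0, 1]%R].
have mbox : measurable box.
  rewrite (_ : box = \bigcap_(i in [set: 'I_n]) ((fun t => tnth t i) @^-1` `[0, 1])).
    apply: fin_bigcap_measurable => // i _.
    by rewrite -[X in measurable X]setTI; apply: measurable_tnth.
  by apply/seteqP; split => t /= h; [move=> i _; exact: h | move=> i; exact: h].
apply: (@le_lt_trans _ _ (@sigma_leb R n box)).
  apply: le_measure; rewrite ?inE//; first exact: measurable_ref_simplex.
  move=> t ht i; have [h0 _] := ht.
  have := h0 i; have := ref_simplex_le1 i ht; rewrite !mxE in_itv/= => h1 h2.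
  by rewrite h2 -(ger0_norm h2).
rewrite /sigma_leb (leb_box (A := fun=> `[0, 1]%classic))// big1 ?ltry// => i _.
by rewrite lebesgue_measure_itv /= lte_fin ltr01 oppr0 adde0.
Qed.

Lemma polyfun_integrable n (f : 'rV[R]_n -> R) : polyfun f ->
  (@sigma_leb R n).-integrable (@rV_of_tuple R n @^-1` (@ref_simplex R n))
    (fun t => (f (rV_of_tuple t))%:E).
Proof.
move=> pf.
apply: (@measurable_bounded_integrable _ _ _ _ (fun t => f (rV_of_tuple t))).
- exact: measurable_ref_simplex.
- exact: ref_simplex_finite.
- by apply: measurable_funTS; exact: polyfun_measurable.
have [B B0 hB] := polyfun_bounded pf.
exists B; split => [|M BM t ht]; first exact: ger0_real.
 apply: le_trans (ltW BM).
by apply: hB => i; exact: ref_simplex_le1.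
Qed.

Definition ref_int n (f : 'rV[R]_n -> R) : R := integral_rV (@ref_simplex R n) f.

Lemma ref_intD n (f g : 'rV[R]_n -> R) : polyfun f -> polyfun g ->
  ref_int (fun s => f s + g s) = ref_int f + ref_int g.
Proof.
move=> pf pg; apply: (RintegralD (mu := @sigma_leb R n)).
- exact: measurable_ref_simplex.
- exact: polyfun_integrable.
- exact: polyfun_integrable.
Qed.

Lemma ref_intZ n c (f : 'rV[R]_n -> R) : polyfun f ->
  ref_int (fun s => c * f s) = c * ref_int f.
Proof.
move=> pf; apply: (RintegralZl (mu := @sigma_leb R n)).
- exact: measurable_ref_simplex.
- exact: polyfun_integrable.
Qed.

Lemma ref_intB k (f g : 'rV[R]_k -> R) : polyfun f -> polyfun g ->
  ref_int (fun s => f s - g s) = ref_int f - ref_int g.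
Proof.
move=> pf pg; rewrite -(mulN1r (ref_int g)) -ref_intZ// -ref_intD//.
  by congr ref_int; apply/funext => s; rewrite mulN1r.
exact: polyfunZ.
Qed.

Lemma ref_int_sum n (I : Type) (r : seq I) (f : I -> 'rV[R]_n -> R) :
  (forall i, polyfun (f i)) ->
  ref_int (fun s => \sum_(i <- r) f i s) = \sum_(i <- r) ref_int (f i).
Proof.
move=> pf; elim: r => [|i r IH].
  rewrite big_nil (_ : (fun _ => _) = fun s => 0 * 0).
    by rewrite (ref_intZ 0 (polyfun_cst n 0)) mul0r.
  by apply/funext => s; rewrite big_nil mul0r.
rewrite big_cons -IH -ref_intD//; last exact: polyfun_sum.
by congr ref_int; apply/funext => s; rewrite big_cons.
Qed.

Lemma FTC_poly (P : {poly R}) a b : a <= b ->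
  (\int[lambda]_(x in `[a, b]) (P^`().[x])%:E = (P.[b] - P.[a])%:E)%E.
Proof.
rewrite le_eqVlt => /predU1P[->|ab].
  by rewrite set_itv1 integral_set1 subrr.
have cP (Q : {poly R}) : continuous (fun x => Q.[x]) by exact: continuous_horner.
rewrite (continuous_FTC2 (F := fun x => P.[x]) ab)//.
- exact: continuous_subspaceT.
- split.
  + by move=> x _; exact: derivable_horner.
  + by apply: cvg_at_right_filter; exact: cP.
  + by apply: cvg_at_left_filter; exact: cP.
- by move=> x _; rewrite derivE.
Qed.

End IntegralRV.

(** * Barycentric coordinates on the reference simplex and reordering of vertices *)

Section ReferenceSimplex.
Variable R : realType.

(** Slices the simplex along its first coordinate into intervals, the domains on which the
    fundamental theorem of calculus is applied. *)
Lemma ref_simplex_row_mx n (x : R) (t : 'rV[R]_n) :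
  @ref_simplex R n.+1 (row_mx x%:M t : 'rV_(1 + n)) <->
  ref_simplex t /\ 0 <= x <= 1 - \sum_j t 0 j.
Proof.
have sumE : \sum_j (row_mx x%:M t : 'rV[R]_(1 + n)) 0 j = x + \sum_j t 0 j.
  rewrite big_split_ord/= big_ord1 row_mxEl mxE; congr (_ + _).
  by apply: eq_bigr => i _; rewrite row_mxEr.
have x0 : (row_mx x%:M t : 'rV[R]_(1 + n)) 0 (lshift n 0) = x by rewrite row_mxEl mxE.
have tE j : (row_mx x%:M t : 'rV[R]_(1 + n)) 0 (rshift 1 j) = t 0 j by rewrite row_mxEr.
split.
  move=> [h0 h1]; have := h0 (@lshift 1 n 0); rewrite x0 => xx.
  rewrite sumE in h1; split; last by rewrite xx/=; lra.
  by split; [move=> j; have := h0 (@rshift 1 n j); rewrite tE|lra].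
move=> [[t0 t1] /andP[xge xle]]; split; last by rewrite sumE; lra.
by move=> j; case: (@split_ordP 1 n j) => k ->; rewrite ?tE// ord1 x0.
Qed.

(** Fubini puts the first coordinate innermost, and on each fibre [g] is the derivative of [f]. The
    two end points of the fibres describe the slanted face and the face of vanishing first
    coordinate. *)
Lemma ref_int_derivative n (f g : 'rV[R]_n.+1 -> R) : polyfun f -> polyfun g ->
  (forall t : 'rV[R]_n, exists P : {poly R}, forall x,
     f (row_mx x%:M t : 'rV_(1 + n)) = P.[x] /\
     g (row_mx x%:M t : 'rV_(1 + n)) = P^`().[x]) ->
  ref_int g = ref_int (fun t : 'rV_n =>
    f (row_mx (1 - \sum_j t 0 j)%:M t : 'rV_(1 + n)) -
    f (row_mx 0 t : 'rV_(1 + n))).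
Proof.
move=> pf pg fg; rewrite /ref_int !integral_rVE.
have mg := measurable_rv_integrand (@measurable_ref_simplex R n.+1) (polyfun_measurable pg).
rewrite fubini_head//; last first.
  have := polyfun_integrable pg.
  move=> /(integrable_mkcond _ (@measurable_ref_simplex R n.+1)).
  by move=> /integrableP[_].
congr (fine (tint _)); apply/funext => t.
rewrite /rv_integrand [RHS]/patch; case: ifPn => ht; last first.
  rewrite [LHS]integral0_eq// => x _; rewrite /patch ifF//.
  apply/negbTE; apply: contra ht; rewrite !inE/= rV_of_tcons/=.
  by move=> /ref_simplex_row_mx[].
move: ht; rewrite inE/= => ht.
have [P PE] := fg (rV_of_tuple t).
set S := \sum_j _.
have S1 : 0 <= 1 - S by case: ht => _; rewrite subr_ge0.
rewrite (PE _).1 (_ : 0 = 0%:M) ?(PE _).1; last by rewrite raddf0.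
rewrite -(FTC_poly P S1) [RHS]integral_mkcond; apply: eq_integral => x _.
rewrite /patch !rV_of_tcons/= (PE _).2.
have -> // : (tcons (x, t) \in @rV_of_tuple R n.+1 @^-1` ref_simplex (m:=n.+1)) =
  (x \in `[0, 1 - S]%classic).
apply/idP/idP; rewrite !inE/= in_itv/= rV_of_tcons/=.
  by move=> /ref_simplex_row_mx[].
by move=> ?; apply/ref_simplex_row_mx.
Qed.

Definition param m n (w : 'I_m.+1 -> 'rV[R]_n) (s : 'rV[R]_m) : 'rV[R]_n :=
  w ord0 + s *m edges w.

Lemma polyfun_param m n (w : 'I_m.+1 -> 'rV[R]_n) f :
  polyfun f -> polyfun (fun s => f (param w s)).
Proof. exact: polyfun_affine. Qed.

(** Barycentric coordinates with respect to the origin, taken as vertex 0, and the standard basis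
    vectors. *)
Definition bary m (s : 'rV[R]_m) (i : 'I_m.+1) : R :=
  if unlift ord0 i is Some j then s 0 j else 1 - \sum_j s 0 j.

(** The linear part of [bary], which acts on differences of points. *)
Definition blin m (s : 'rV[R]_m) (i : 'I_m.+1) : R :=
  if unlift ord0 i is Some j then s 0 j else - \sum_j s 0 j.

Lemma bary0 m (s : 'rV[R]_m) : bary s ord0 = 1 - \sum_j s 0 j.
Proof. by rewrite /bary unlift_none. Qed.

Lemma baryS m (s : 'rV[R]_m) j : bary s (lift ord0 j) = s 0 j.
Proof. by rewrite /bary liftK. Qed.

Lemma blin0 m (s : 'rV[R]_m) : blin s ord0 = - \sum_j s 0 j.
Proof. by rewrite /blin unlift_none. Qed.

Lemma blinS m (s : 'rV[R]_m) j : blin s (lift ord0 j) = s 0 j.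
Proof. by rewrite /blin liftK. Qed.

Lemma sum_bary m (s : 'rV[R]_m) : \sum_i bary s i = 1.
Proof.
rewrite big_ord_recl bary0 [X in _ + X](eq_bigr (fun j => s 0 j)) ?subrK//.
by move=> j _; rewrite baryS.
Qed.

Lemma sum_blin m (s : 'rV[R]_m) : \sum_i blin s i = 0.
Proof.
rewrite big_ord_recl blin0 [X in _ + X](eq_bigr (fun j => s 0 j)) ?addNr//.
by move=> j _; rewrite blinS.
Qed.

Lemma baryD m (s u : 'rV[R]_m) i : bary (s + u) i = bary s i + blin u i.
Proof.
case: (unliftP ord0 i) => [j|] ->; first by rewrite !baryS blinS mxE.
rewrite !bary0 blin0 (eq_bigr (fun j => s 0 j + u 0 j)); last by move=> j _; rewrite mxE.
by rewrite big_split/= opprD addrA.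
Qed.

Lemma blinD m (s u : 'rV[R]_m) i : blin (s + u) i = blin s i + blin u i.
Proof.
case: (unliftP ord0 i) => [j|] ->; first by rewrite !blinS mxE.
rewrite !blin0 (eq_bigr (fun j => s 0 j + u 0 j)); last by move=> j _; rewrite mxE.
by rewrite big_split/= opprD.
Qed.

Lemma blinZ m c (s : 'rV[R]_m) i : blin (c *: s) i = c * blin s i.
Proof.
case: (unliftP ord0 i) => [j|] ->; first by rewrite !blinS mxE.
rewrite !blin0 mulrN mulr_sumr; congr (- _); by apply: eq_bigr => j _; rewrite mxE.
Qed.

Lemma ref_simplex_bary m (s : 'rV[R]_m) :
  ref_simplex s <-> forall i, 0 <= bary s i.
Proof.
split=> [[h0 h1] i|h].
  by case: (unliftP ord0 i) => [j|] ->; rewrite ?baryS ?bary0 ?subr_ge0.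
by split=> [j|]; [rewrite -baryS|rewrite -subr_ge0 -bary0].
Qed.

Lemma mulmx_edges m n (w : 'I_m.+1 -> 'rV[R]_n) s :
  s *m edges w = \sum_i blin s i *: w i.
Proof.
rewrite big_ord_recl blin0 scaleNr scaler_suml -sumrN -big_split/=.
apply/rowP => j; rewrite mxE summxE; apply: eq_bigr => i _.
by rewrite !mxE blinS mulrBr addrC.
Qed.

Lemma paramE m n (w : 'I_m.+1 -> 'rV[R]_n) s :
  param w s = \sum_i bary s i *: w i.
Proof.
rewrite /param mulmx_edges !big_ord_recl addrA bary0 blin0.
rewrite scalerBl scale1r scaleNr; congr (_ + _).
by apply: eq_bigr => i _; rewrite baryS blinS.
Qed.

Definition ref_vertex m (i : 'I_m.+1) : 'rV[R]_m :=
  if unlift ord0 i is Some j then delta_mx 0 j else 0.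

Lemma bary_ref_vertex m (i j : 'I_m.+1) : bary (ref_vertex i) j = (j == i)%:R.
Proof.
rewrite /ref_vertex; case: (unliftP ord0 i) => [k|] ->;
  case: (unliftP ord0 j) => [l|] ->; rewrite ?baryS ?bary0 ?mxE ?eqxx.
- by rewrite (inj_eq lift_inj).
- rewrite (bigD1 k)//= mxE !eqxx big1 ?addr0 ?subrr//.
  by move=> i' /negbTE i'k; rewrite mxE i'k andbF.
- by [].
- by rewrite big1 ?subr0// => i' _; rewrite mxE.
Qed.

Lemma param_ref_vertex m n (w : 'I_m.+1 -> 'rV[R]_n) i :
  param w (ref_vertex i) = w i.
Proof.
rewrite paramE (bigD1 i)//= bary_ref_vertex eqxx scale1r big1 ?addr0// => j ji.
by rewrite bary_ref_vertex (negbTE ji) scale0r.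
Qed.

Lemma row_edges m n (w : 'I_m.+1 -> 'rV[R]_n) i :
  row i (edges w) = w (lift ord0 i) - w ord0.
Proof. by apply/rowP => j; rewrite !mxE. Qed.

Lemma paramB m n (w : 'I_m.+1 -> 'rV[R]_n) s t :
  param w s - param w t = (s - t) *m edges w.
Proof. by rewrite /param opprD addrACA subrr add0r mulmxBl. Qed.

Lemma edges_param m n k (u : 'I_k.+1 -> 'rV[R]_m) (w : 'I_m.+1 -> 'rV[R]_n) :
  edges (fun i => param w (u i)) = edges u *m edges w.
Proof. by apply/row_matrixP => i; rewrite row_mul !row_edges paramB. Qed.

Lemma param_comp m n k (u : 'I_k.+1 -> 'rV[R]_m) (w : 'I_m.+1 -> 'rV[R]_n) s :
  param (fun i => param w (u i)) s = param w (param u s).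
Proof.
by rewrite {1}/param edges_param mulmxA {2}/param mulmxDl addrA.
Qed.

Lemma edges_ref_vertex m : edges (@ref_vertex m) = 1%:M.
Proof.
apply/matrixP => i j; rewrite !mxE /ref_vertex liftK unlift_none !mxE subr0.
by rewrite eq_sym.
Qed.

(** Barycentric coordinates are affine, so they commute with combinations whose weights sum to 1. *)
Lemma bary_param m k (u : 'I_k.+1 -> 'rV[R]_m) s j :
  bary (param u s) j = \sum_i bary s i * bary (u i) j.
Proof.
have blin_sum (r : seq 'I_k.+1) c :
    blin (\sum_(i <- r) c i *: u i) j = \sum_(i <- r) c i * blin (u i) j.
  elim/big_rec2 : _ => [|i y x _ IH]; last by rewrite blinD blinZ IH.
  by rewrite -(scale0r (0 : 'rV_m)) blinZ mul0r.
have bE x : bary x j = bary 0 j + blin x j by rewrite -baryD add0r.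
rewrite bE paramE blin_sum -[bary 0 j]mul1r -(sum_bary s) mulr_suml -big_split/=.
by apply: eq_bigr => i _; rewrite (bE (u i)) mulrDr.
Qed.

Section Reordering.
Variable m : nat.
Implicit Type sigma : {perm 'I_m.+1}.

(** The linear part of the affine automorphism of the reference simplex that permutes its vertices
    by [sigma]. *)
Definition reorder_mx sigma : 'M[R]_m := edges (fun i => ref_vertex (sigma i)).

Lemma edges_reorder n (w : 'I_m.+1 -> 'rV[R]_n) sigma :
  edges (fun i => w (sigma i)) = reorder_mx sigma *m edges w.
Proof.
rewrite -edges_param; congr edges; apply/funext => i.
by rewrite param_ref_vertex.
Qed.

Lemma param_reorder n (w : 'I_m.+1 -> 'rV[R]_n) sigma s :
  param (fun i => w (sigma i)) s =
  param w (param (fun i => ref_vertex (sigma i)) s).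
Proof.
rewrite -param_comp; congr (param _ s); apply/funext => i.
by rewrite param_ref_vertex.
Qed.

Lemma bary_reorder sigma s i :
  bary (param (fun i => ref_vertex (sigma i)) s) (sigma i) = bary s i.
Proof.
rewrite bary_param.
rewrite (bigD1 i)//= bary_ref_vertex eqxx mulr1 big1 ?addr0// => k ki.
by rewrite bary_ref_vertex (inj_eq perm_inj) eq_sym (negbTE ki) mulr0.
Qed.

(* Reordering is multiplicative in sigma, and sigma has finite order. *)
Lemma det_reorder sigma : `|\det (reorder_mx sigma)| = 1.
Proof.
have reorderM s t : reorder_mx (s * t)%g = reorder_mx s *m reorder_mx t.
  rewrite -edges_reorder; congr edges; apply/funext => i.
  by rewrite permM.
have reorder1 : reorder_mx 1%g = 1%:M.
  by rewrite -edges_ref_vertex; congr edges; apply/funext => i; rewrite perm1.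
have reorderX k : \det (reorder_mx (sigma ^+ k)%g) = \det (reorder_mx sigma) ^+ k.
  elim: k => [|k IH]; first by rewrite expg0 reorder1 det1.
  by rewrite expgS reorderM det_mulmx IH exprS.
apply/eqP; rewrite -(@pexpr_eq1 _ _ #[sigma]%g)//.
by rewrite -normrX -reorderX expg_order reorder1 det1 normr1.
Qed.

(** Reordering the vertices amounts to composing with an affine automorphism of the reference
    simplex of determinant 1 or -1. *)
Lemma ref_int_reorder n (w : 'I_m.+1 -> 'rV[R]_n) sigma f : polyfun f ->
  ref_int (fun s => f (param (fun i => w (sigma i)) s)) =
  ref_int (fun s => f (param w s)).
Proof.
move=> pf.
have pw : polyfun (fun s => f (param w s)) by exact: polyfun_param.
rewrite [RHS]/ref_int (@integral_rV_affine _ _ (reorder_mx sigma)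
  (ref_vertex (sigma ord0))).
- rewrite det_reorder mul1r /ref_int.
  have -> : [set s | ref_simplex (ref_vertex (sigma ord0) + s *m reorder_mx sigma)] =
      @ref_simplex R m.
    apply/seteqP; split => s /=.
      move=> /ref_simplex_bary h; apply/ref_simplex_bary => i.
      by rewrite -(bary_reorder sigma); exact: h.
    move=> /ref_simplex_bary h; apply/ref_simplex_bary => i.
    by rewrite -[i](permKV sigma) [leRHS](bary_reorder sigma).
  congr integral_rV; apply/funext => s; congr f.
  exact: param_reorder.
- by rewrite unitmxE unitfE -normr_gt0 det_reorder ltr01.
- exact: measurable_ref_simplex.
- exact: (polyfun_measurable pw).
Qed.

Lemma abs_det_edges_reorder (w : 'I_m.+1 -> 'rV[R]_m) sigma :
  `|\det (edges (fun i => w (sigma i)))| = `|\det (edges w)|.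
Proof. by rewrite edges_reorder det_mulmx normrM det_reorder mul1r. Qed.

Lemma det_gram_reorder n (w : 'I_m.+1 -> 'rV[R]_n) sigma :
  \det (edges (fun i => w (sigma i)) *m (edges (fun i => w (sigma i)))^T) =
  \det (edges w *m (edges w)^T).
Proof.
rewrite edges_reorder trmx_mul mulmxA -(mulmxA _ (edges w)) !det_mulmx det_tr.
by rewrite mulrAC -expr2 -real_normK ?num_real// det_reorder expr1n mul1r.
Qed.

End Reordering.

Lemma same_range_reorder m (T : eqType) (u v : 'I_m -> T) :
  injective u -> injective v -> range u = range v ->
  exists sigma : {perm 'I_m}, forall i, u i = v (sigma i).
Proof.
move=> iu iv uv.
have ex i : exists j, v j == u i.
  have : range v (u i) by rewrite -uv; exists i.
  by case=> j _ h; exists j; apply/eqP.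
pose s i := xchoose (ex i).
have vs i : v (s i) = u i by exact/eqP/(xchooseP (ex i)).
have si : injective s by move=> i j h; apply: iu; rewrite -!vs h.
by exists (perm si) => i; rewrite permE vs.
Qed.

Lemma range_reorder_lift n (T : Type) (u : 'I_n.+1 -> T) (sigma : {perm 'I_n.+1}) k :
  range (fun i => u (sigma (lift k i))) = [set u i | i in [set i | i != sigma k]].
Proof.
apply/seteqP; split => [y [i _ <-]|y [i /= ik <-]].
  by exists (sigma (lift k i)); rewrite //= (inj_eq perm_inj) eq_sym neq_lift.
case: (unliftP k (sigma^-1%g i)) => [j|] E.
  by exists j => //; rewrite -E permKV.
by move: ik; rewrite -E permKV eqxx.
Qed.

Lemma range_lift n (T : Type) (u : 'I_n.+1 -> T) k :
  range (fun i => u (lift k i)) = [set u i | i in [set i | i != k]].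
Proof.
have := range_reorder_lift u 1 k; rewrite perm1 => <-.
by apply: eq_imagel => i _; rewrite perm1.
Qed.

(** Two enumerations of the same vertices differ by a permutation. This is what allows the integrals
    over a face seen from two elements to be compared. *)
Lemma ref_int_range m n (u v : 'I_m.+1 -> 'rV[R]_n) f : polyfun f ->
  injective u -> injective v -> range u = range v ->
  ref_int (fun s => f (param u s)) = ref_int (fun s => f (param v s)).
Proof.
move=> pf iu iv /(same_range_reorder iu iv)[sigma us].
by rewrite (funext us) (ref_int_reorder v sigma pf).
Qed.

Lemma surface_integralE m n (w : 'I_m.+1 -> 'rV[R]_n) f :
  surface_integral w f =
  Num.sqrt (\det (edges w *m (edges w)^T)) * ref_int (fun s => f (param w s)).
Proof. by []. Qed.

Lemma surface_integral_range m n (u v : 'I_m.+1 -> 'rV[R]_n) f : polyfun f ->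
  injective u -> injective v -> range u = range v ->
  surface_integral u f = surface_integral v f.
Proof.
move=> pf iu iv uv; rewrite !surface_integralE (ref_int_range pf iu iv uv).
have [sigma us] := same_range_reorder iu iv uv.
by rewrite (funext us) det_gram_reorder.
Qed.

End ReferenceSimplex.

(** * Multivariate polynomials along lines *)

Section PolynomialFunctions.
Variables (R : realType) (n : nat).
Local Notation MP := (mpoly.mpoly n R).

Definition pev (q : MP) (x : 'rV[R]_n) : R := mpoly.meval (fun i => x 0 i) q.

Lemma pevD p q x : pev (p + q) x = pev p x + pev q x.
Proof. exact: mpoly.mevalD. Qed.

Lemma pevM p q x : pev (p * q) x = pev p x * pev q x.
Proof. exact: mpoly.mevalM. Qed.

Lemma pevZ c p x : pev (c *: p) x = c * pev p x.
Proof. exact: mpoly.mevalZ. Qed.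

Lemma mpoly_ring_ind (P : MP -> Prop) :
  (forall c, P (mpoly.mpolyC n c)) ->
  (forall i, P (mpoly.mpolyX R (mpoly.mnm1 i))) ->
  (forall p q, P p -> P q -> P (p + q)) ->
  (forall p q, P p -> P q -> P (p * q)) -> forall p, P p.
Proof.
move=> PC PX PD PM p; rewrite [p]mpoly.mpolyE.
elim/big_ind : _ => [||m _]; first by rewrite -mpoly.mpolyC0.
  exact: (PD).
rewrite -mpoly.mul_mpolyC; apply: (PM) => //.
rewrite mpoly.mpolyXE_id; elim/big_ind : _ => [||i _]; first exact: (PC).
  exact: (PM).
elim: (m i) => [|k IH]; first exact: (PC).
by rewrite exprS; exact: PM.
Qed.

Lemma polyfun_pev q : polyfun (pev q).
Proof.
elim/mpoly_ring_ind: q => [c|i|p q Pp Pq|p q Pp Pq].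
- rewrite (_ : pev _ = fun=> c); first exact: polyfun_cst.
  by apply/funext => x; exact: mpoly.mevalC.
- rewrite (_ : pev _ = fun x => x 0 i); first exact: polyfun_coord.
  by apply/funext => x; exact: mpoly.mevalXU.
- by rewrite (funext (pevD p q)); exact: polyfunD.
- by rewrite (funext (pevM p q)); exact: polyfunM.
Qed.

Definition dirderiv (h : 'rV[R]_n) (q : MP) (x : 'rV[R]_n) : R :=
  \sum_j h 0 j * pev (mpoly.mderiv j q) x.

Lemma polyfun_dirderiv h q : polyfun (dirderiv h q).
Proof. by apply: polyfun_sum => j; apply: polyfunZ; exact: polyfun_pev. Qed.

Lemma dirderivD h k q x : dirderiv (h + k) q x = dirderiv h q x + dirderiv k q x.
Proof.
by rewrite -big_split; apply: eq_bigr => j _; rewrite mxE mulrDl.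
Qed.

Lemma dirderivZ c h q x : dirderiv (c *: h) q x = c * dirderiv h q x.
Proof.
by rewrite /dirderiv mulr_sumr; apply: eq_bigr => j _; rewrite mxE mulrA.
Qed.

Lemma dirderiv_delta j q x :
  dirderiv (delta_mx 0 j) q x = pev (mpoly.mderiv j q) x.
Proof.
rewrite /dirderiv (bigD1 j)//= mxE !eqxx mul1r big1 ?addr0// => i ij.
by rewrite mxE (negbTE ij) andbF mul0r.
Qed.

(** Reduces both the fundamental theorem of calculus and the identity theorem to univariate
    polynomials. *)
Lemma line_poly q x h : exists P : {poly R}, forall t,
  P.[t] = pev q (x + t *: h) /\ P^`().[t] = dirderiv h q (x + t *: h).
Proof.
elim/mpoly_ring_ind: q => [c|i|p q [P Pp] [Q Pq]|p q [P Pp] [Q Pq]].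
- exists c%:P => t; rewrite derivC !hornerE /pev mpoly.mevalC; split=> //.
  by rewrite /dirderiv big1// => j _; rewrite mpoly.mderivC /pev mpoly.meval0 mulr0.
- exists ((x 0 i)%:P + (h 0 i) *: 'X) => t.
  rewrite derivD derivC derivZ derivX !hornerE /pev mpoly.mevalXU !mxE mulrC.
  split=> //; rewrite /dirderiv (bigD1 i)//= big1 => [|j ji].
    rewrite addr0 mpoly.mderivX mpoly.mnm1E eqxx scale1r.
    rewrite (_ : mpoly.mnm_sub _ _ = @mpoly.mnm0 n); last first.
      by apply/mpoly.mnmP => k; rewrite mpoly.mnmBE subnn mpoly.mnm0E.
    by rewrite mpoly.mpolyX0 /pev mpoly.meval1 mulr1.
  rewrite mpoly.mderivX mpoly.mnm1E eq_sym (negbTE ji) scale0r.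
  by rewrite /pev mpoly.meval0 mulr0.
- exists (P + Q) => t; rewrite derivD !hornerD pevD !(Pp t).1 !(Pq t).1.
  rewrite (Pp t).2 (Pq t).2; split=> //.
  rewrite -big_split; apply: eq_bigr => j _.
  by rewrite mpoly.mderivD pevD mulrDr.
- exists (P * Q) => t; rewrite derivM hornerD !hornerM pevM !(Pp t).1 !(Pq t).1.
  rewrite (Pp t).2 (Pq t).2; split=> //.
  rewrite mulr_suml mulr_sumr -big_split; apply: eq_bigr => j _.
  by rewrite mpoly.mderivM pevD !pevM mulrDr mulrA (mulrCA (pev p _)).
Qed.

Lemma poly_eq0_near0 (P : {poly R}) (e : R) : 0 < e ->
  (forall t, 0 < t < e -> P.[t] = 0) -> P = 0.
Proof.
move=> e0 h; apply: (@roots_geq_poly_eq0 _ _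
  (* The points [e/2], [e/3], ... lie strictly between 0 and [e], and [size P] distinct roots exceed
     the degree. *)
  [seq e / (i.+2)%:R | i <- iota 0 (size P)]).
- apply/allP => _ /mapP[i _ ->]; apply/eqP; apply: h.
  by rewrite divr_gt0//= ltr_pdivrMr// ltr_pMr// ltr1n.
- rewrite map_inj_uniq ?iota_uniq// => i j /(mulfI (lt0r_neq0 e0))/invr_inj/eqP.
  by rewrite eqr_nat => /eqP[].
- by rewrite size_map size_iota.
Qed.

Lemma msize_mderiv j (q : MP) :
  (mpoly.msize (mpoly.mderiv j q) <= (mpoly.msize q).-1)%N.
Proof.
rewrite mpoly.msizeE; apply/bigmax_leqP_seq => m.
rewrite mpoly.mcoeff_msupp mpoly.mcoeff_deriv => mq _.
have : mpoly.mnm_add m (mpoly.mnm1 j) \in mpoly.msupp q.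
  by rewrite mpoly.mcoeff_msupp; apply: contraNneq mq => ->; rewrite mul0rn.
move=> /mpoly.msize_mdeg_lt; rewrite mpoly.mdegD mpoly.mdeg1 addn1.
by case: (mpoly.msize q).
Qed.

Lemma dirderiv_eq0 q : (forall x, pev q x = 0) -> forall h x, dirderiv h q x = 0.
Proof.
move=> q0 h x; have [P hP] := line_poly q x h.
have P0 : P = 0.
  by apply: (@poly_eq0_near0 P 1) => // t _; rewrite (hP t).1.
by have [_] := hP 0; rewrite scale0r addr0 P0 deriv0 horner0.
Qed.

(** By induction on the degree: the partial derivatives also vanish everywhere, hence are zero
    polynomials, so [q] is a constant, and its value is 0. *)
Lemma pev_eq0 q : (forall x, pev q x = 0) -> q = 0.
Proof.
have [N] := ubnP (mpoly.msize q); elim: N q => // N IH q qN q0.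
have d0 j : mpoly.mderiv j q = 0.
  case: N IH qN => [|N] IH qN.
    have /eqP : mpoly.msize q = 0%N by case: (mpoly.msize q) qN.
    by rewrite mpoly.msize_poly_eq0 => /eqP ->; rewrite mpoly.mderiv0.
  apply: IH => [|x]; last by rewrite -dirderiv_delta dirderiv_eq0.
  by apply: leq_trans (msize_mderiv j q) _; case: (mpoly.msize q) qN.
suff qE : q = mpoly.mpolyC n (mpoly.mcoeff (@mpoly.mnm0 n) q).
  by have := q0 0; rewrite qE /pev mpoly.mevalC => ->; rewrite mpoly.mpolyC0.
apply/mpoly.mpolyP => m; rewrite mpoly.mcoeffC.
case: eqVneq => [->|mn0]; rewrite ?mulr1// mulr0.
have [i mi] : exists i, mpoly.fun_of_multinom m i != 0%N.
  apply/existsP; apply: contraNT mn0; rewrite negb_exists => /forallP h.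
  by apply/eqP/mpoly.mnmP => i; rewrite mpoly.mnm0E; apply/eqP; have := h i; rewrite negbK.
(* This coefficient of the derivative is the one of [q] at [m] times the exponent [m i], which is
   nonzero and cancels in characteristic 0. *)
have := congr1 (mpoly.mcoeff (mpoly.mnm_sub m (mpoly.mnm1 i))) (d0 i).
rewrite mpoly.mcoeff_deriv mpoly.mcoeff0 mpoly.submK ?mpoly.lep1mP//.
by move=> /eqP; rewrite mulrn_eq0 => /eqP.
Qed.

(** Along the line through [y] and [z] both sides are polynomials in [t], so equality on a short
    initial piece reaches [z]. The translation [s] accounts for periodic identification. *)
Lemma pev_line_eq p q s y z e : 0 < e ->
  (forall t, 0 < t < e ->
    pev p (y + t *: (z - y)) = pev q (y + t *: (z - y) + s)) ->
  pev p z = pev q (z + s).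
Proof.
move=> e0 h; have [P hP] := line_poly p y (z - y).
have [Q hQ] := line_poly q (y + s) (z - y).
have PQ : P - Q = 0.
  apply: (poly_eq0_near0 e0) => t te; rewrite hornerD hornerN (hP t).1 (hQ t).1.
  by rewrite h// [y + s + _]addrAC subrr.
have := congr1 (horner^~ 1) PQ; rewrite hornerD hornerN horner0 (hP 1).1 (hQ 1).1.
rewrite !scale1r addrAC [y + (z - y)]addrC subrK => /eqP.
by rewrite subr_eq0 => /eqP.
Qed.

(** Equality along one line controls the derivative in its direction only; this is why just the
    tangential derivatives can be compared across a face. *)
Lemma dirderiv_line_eq p q s x h :
  (forall t, pev p (x + t *: h) = pev q (x + t *: h + s)) ->
  dirderiv h p x = dirderiv h q (x + s).
Proof.
move=> pq; have [P hP] := line_poly p x h.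
have [Q hQ] := line_poly q (x + s) h.
have PQ : P = Q.
  apply/eqP; rewrite -subr_eq0; apply/eqP; apply: (poly_eq0_near0 ltr01) => t _.
  by rewrite hornerD hornerN (hP t).1 (hQ t).1 pq addrAC subrr.
by have := (hP 0).2; rewrite PQ (hQ 0).2 scale0r !addr0.
Qed.

End PolynomialFunctions.

(** * The divergence theorem on a simplex *)

Section DotProduct.
Variable R : realType.

Lemma dotp_delta k (v : 'rV[R]_k) j : dotp v (delta_mx 0 j) = v 0 j.
Proof.
rewrite /dotp (bigD1 j)//= mxE !eqxx mulr1 big1 ?addr0// => i ij.
by rewrite mxE (negbTE ij) andbF mulr0.
Qed.

Lemma dotpE k (x y : 'rV[R]_k) : dotp x y = (x *m y^T) 0 0.
Proof. by rewrite mxE; apply: eq_bigr => i _; rewrite mxE. Qed.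

Lemma dotpC k (x y : 'rV[R]_k) : dotp x y = dotp y x.
Proof. by apply: eq_bigr => i _; rewrite mulrC. Qed.

Lemma dotpDr k (x y z : 'rV[R]_k) : dotp x (y + z) = dotp x y + dotp x z.
Proof. by rewrite !dotpE linearD mulmxDr mxE. Qed.

Lemma dotpZr k c (x y : 'rV[R]_k) : dotp x (c *: y) = c * dotp x y.
Proof. by rewrite !dotpE linearZ/= -scalemxAr mxE. Qed.

Lemma dotpZl k c (x y : 'rV[R]_k) : dotp (c *: x) y = c * dotp x y.
Proof. by rewrite dotpC dotpZr dotpC. Qed.

Lemma dotpBr k (x y z : 'rV[R]_k) : dotp x (y - z) = dotp x y - dotp x z.
Proof. by rewrite -scaleN1r dotpDr dotpZr mulN1r. Qed.

Lemma dotp_gt0 k (x : 'rV[R]_k) : x != 0 -> 0 < dotp x x.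
Proof.
move=> x0; rewrite lt_def sumr_ge0 ?andbT; last by move=> i _; rewrite -expr2 sqr_ge0.
apply: contra x0 => /eqP h; apply/eqP/rowP => i; rewrite mxE.
have xx0 : x 0 i * x 0 i = 0.
  by move: h => /psumr_eq0P; apply=> // j _; rewrite -expr2 sqr_ge0.
by move/eqP: xx0; rewrite mulf_eq0 orbb => /eqP.
Qed.

(* The matrix with rows g and F = dsubmx B has Gram matrix diag(g.g, F F^T), and
   it is the product of a triangular matrix with diagonal (g.g, 1) and B. *)
Lemma det_gram_complement k (B : 'M[R]_(1 + k)) (g : 'rV[R]_(1 + k)) :
  B \in unitmx -> B *m g^T = delta_mx 0 0 ->
  \det (dsubmx B *m (dsubmx B)^T) = dotp g g * \det B ^+ 2.
Proof.
move=> uB Bg; pose F := dsubmx B.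
have Fg : F *m g^T = 0.
  rewrite mul_dsub_mx Bg; apply/matrixP => i j; rewrite !mxE.
  by rewrite (_ : _ == 0 = false).
have gF : g *m F^T = 0 by rewrite -[LHS]trmxK trmx_mul trmxK Fg trmx0.
have Bg' : invmx B *m delta_mx 0 0 = g^T by rewrite -Bg mulKmx.
have g0 : g != 0.
  apply/eqP => g0; move: Bg; rewrite g0 trmx0 mulmx0 => /matrixP/(_ 0 0)/eqP.
  by rewrite !mxE eqxx eq_sym oner_eq0.
have FB : F *m invmx B = row_mx 0 1%:M.
  rewrite /F mul_dsub_mx mulmxV//; apply/matrixP => i j; rewrite !mxE.
  by case: splitP => l jl; rewrite !mxE -val_eqE/= jl ?ord1.
pose C := col_mx g F.
have dC : \det C = dotp g g * \det B.
  rewrite -[C](mulmxKV uB) det_mulmx; congr (_ * _).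
  rewrite mul_col_mx FB -[g *m _]hsubmxK det_ublock det1 mulr1.
  rewrite [lsubmx _]mx11_scalar det_scalar1 mxE dotpE -Bg' mulmxA.
  by rewrite -colE [RHS]mxE; congr ((_ *m _) _ _); exact: val_inj.
have : \det (C *m C^T) = dotp g g * \det (F *m F^T).
  rewrite tr_col_mx mul_col_row Fg gF det_lblock [g *m _]mx11_scalar.
  by rewrite det_scalar1 -dotpE.
rewrite det_mulmx det_tr dC => h.
have n0 : dotp g g != 0 by rewrite gt_eqF// dotp_gt0.
by apply: (mulfI n0); rewrite -h; ring.
Qed.

End DotProduct.

(** * Convex hulls and barycentric coordinates of a simplex *)

Section ConvexSets.
Variables (R : realType) (n : nat).

Lemma convex_setP (C : set 'rV[R]_n) : @convex_set R 'rV[R]_n C <->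
  forall x y (l : R), 0 <= l <= 1 -> C x -> C y -> C (l *: x + (1 - l) *: y).
Proof.
split=> [cC x y l /andP[l0 l1] Cx Cy|cC x y l].
  have := cC x y (Itv01 l0 l1); rewrite !inE; exact.
rewrite !inE => Cx Cy; apply: cC => //.
by apply/andP; split.
Qed.

(** The weights may have any total, which lets the induction on the list go through; the first
    alternative is the case where all of them vanish. Membership is asked only where the weight is
    nonzero, so that faces are covered too. *)
Lemma convex_set_sum (C : set 'rV[R]_n) (I : Type) (r : seq I) (c : I -> R)
    (v : I -> 'rV[R]_n) :
  @convex_set R 'rV[R]_n C -> (forall i, 0 <= c i) ->
  (forall i, c i != 0 -> C (v i)) ->
  (\sum_(i <- r) c i = 0 /\ \sum_(i <- r) c i *: v i = 0) \/
  (0 < \sum_(i <- r) c i /\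
   C ((\sum_(i <- r) c i)^-1 *: \sum_(i <- r) c i *: v i)).
Proof.
move=> /convex_setP cC c0 Cv; elim: r => [|i r IH]; first by left; rewrite !big_nil.
rewrite !big_cons; have [ci|ci] := eqVneq (c i) 0.
  by rewrite ci scale0r !add0r.
have cp : 0 < c i by rewrite lt_def ci c0.
case: IH => [[-> ->]|[Sp CS]]; right.
  by rewrite !addr0 scalerA mulVf// scale1r; split=> //; exact: Cv.
set S := \sum_(_ <- _) _ in Sp CS *; have TS : 0 < c i + S by exact: addr_gt0.
split=> //.
have := cC _ _ (c i / (c i + S)) _ (Cv i ci) CS.
rewrite scalerDr !scalerA (mulrC (c i)).
have -> : (1 - (c i + S)^-1 * c i) / S = (c i + S)^-1.
  by field; rewrite !gt_eqF.
apply; rewrite mulr_ge0 ?invr_ge0 ?(ltW TS)//= mulrC ler_pdivrMr// mul1r.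
by rewrite lerDl ltW.
Qed.

End ConvexSets.

Section SimplexGeometry.
Variables (R : realType) (m : nat) (w : 'I_m.+1 -> 'rV[R]_m).
Hypothesis uw : edges w \in unitmx.

Definition coords (x : 'rV[R]_m) : 'rV[R]_m := (x - w ord0) *m invmx (edges w).

(** Barycentric coordinates with respect to the vertices [w]. *)
Definition lam (x : 'rV[R]_m) (i : 'I_m.+1) : R := bary (coords x) i.

(** The constant gradient of the affine function [lam] at index [i]. *)
Definition grad (i : 'I_m.+1) : 'rV[R]_m :=
  \row_j blin (delta_mx 0 j *m invmx (edges w)) i.

Lemma coordsK x : param w (coords x) = x.
Proof. by rewrite /param mulmxKV// addrC subrK. Qed.

Lemma paramK s : coords (param w s) = s.
Proof. by rewrite /coords /param addrAC subrr add0r mulmxK. Qed.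

Lemma lam_param s i : lam (param w s) i = bary s i.
Proof. by rewrite /lam paramK. Qed.

Lemma sum_lam x : \sum_i lam x i = 1. Proof. exact: sum_bary. Qed.

Lemma lamK x : \sum_i lam x i *: w i = x.
Proof. by rewrite -paramE coordsK. Qed.

Lemma lam_vertex j i : lam (w j) i = (i == j)%:R.
Proof. by rewrite -(param_ref_vertex w j) lam_param bary_ref_vertex. Qed.

Lemma vertex_inj : injective w.
Proof.
move=> i j ij; have := lam_vertex i i.
by rewrite ij lam_vertex eqxx; case: eqVneq => // _ /eqP; rewrite eq_sym oner_eq0.
Qed.

Lemma dotp_grad i h : dotp (grad i) h = blin (h *m invmx (edges w)) i.
Proof.
have lin (I : Type) (r : seq I) (c : I -> R) (v : I -> 'rV[R]_m) :
    blin ((\sum_(k <- r) c k *: v k) *m invmx (edges w)) i =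
    \sum_(k <- r) c k * blin (v k *m invmx (edges w)) i.
  elim: r => [|k r IH]; last by rewrite !big_cons mulmxDl -scalemxAl blinD blinZ IH.
  by rewrite !big_nil mul0mx -(scale0r (0 : 'rV_m)) blinZ mul0r.
rewrite [in RHS](row_sum_delta h) lin; apply: eq_bigr => j _.
by rewrite mxE mulrC.
Qed.

Lemma lamD x h i : lam (x + h) i = lam x i + dotp (grad i) h.
Proof. by rewrite dotp_grad /lam /coords addrAC mulmxDl baryD. Qed.

Lemma dotp_grad_sub i x y : dotp (grad i) (x - y) = lam x i - lam y i.
Proof. by rewrite -[in RHS](subrK y x) [x - y + y]addrC lamD addrAC subrr add0r. Qed.

Lemma sum_grad h : \sum_i dotp (grad i) h = 0.
Proof. by under eq_bigr do rewrite dotp_grad; exact: sum_blin. Qed.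

Lemma gradK h : \sum_i dotp (grad i) h *: w i = h.
Proof.
under eq_bigr do rewrite dotp_grad.
by rewrite -mulmx_edges mulmxKV.
Qed.

Definition simplex_face (P : set 'I_m.+1) : set 'rV[R]_m :=
  [set x | forall i, 0 <= lam x i /\ (~ P i -> lam x i = 0)].

Lemma lam_conv x y l i :
  lam (l *: x + (1 - l) *: y) i = l * lam x i + (1 - l) * lam y i.
Proof.
rewrite (_ : l *: x + _ = y + l *: (x - y)); last first.
  by rewrite scalerBl scale1r scalerBr addrCA addrA.
rewrite lamD dotp_grad -scalemxAl blinZ -dotp_grad dotp_grad_sub; ring.
Qed.

(** The right-hand side is convex and contains the vertices; conversely each of its points is the
    combination of vertices with weights [lam]. *)
Lemma conv_hull_vertices (P : set 'I_m.+1) :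
  conv_hull [set w i | i in P] = simplex_face P.
Proof.
apply/seteqP; split => x.
  apply; split.
    apply/convex_setP => a b l /andP[l0 l1] ha hb i; rewrite lam_conv.
    have [a0 ai] := ha i; have [b0 bi] := hb i.
    split=> [|nPi]; first by rewrite addr_ge0 ?mulr_ge0 ?subr_ge0.
    by rewrite ai// bi// !mulr0 addr0.
  move=> _ [i Pi <-] j; rewrite lam_vertex ler0n; split=> // nPj.
  by case: eqVneq => // ji; move: nPj; rewrite ji.
move=> hx C [cC sC].
have lC i : lam x i != 0 -> C (w i).
  move=> li; apply: sC; exists i => //; apply: contrapT => nPi.
  by move: li; rewrite (hx i).2// eqxx.
case: (convex_set_sum (index_enum 'I_m.+1) cC (fun i => (hx i).1) lC) => -[].
  by rewrite sum_lam => /eqP; rewrite oner_eq0.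
by rewrite sum_lam lamK invr1 scale1r.
Qed.

Lemma conv_hull_range : conv_hull (range w) = [set x | forall i, 0 <= lam x i].
Proof.
rewrite conv_hull_vertices; apply/seteqP; split => x h i; first exact: (h i).1.
by split=> [|/(_ Logic.I)//]; exact: h.
Qed.

Lemma integral_simplex f : polyfun f ->
  integral_rV (conv_hull (range w)) f =
  `|\det (edges w)| * ref_int (fun s => f (param w s)).
Proof.
move=> pf; rewrite (integral_rV_affine (w ord0) uw); first last.
- exact: (polyfun_measurable pf).
- have -> : @rV_of_tuple R m @^-1` conv_hull (range w) =
      aff (invmx (edges w)) (- w ord0 *m invmx (edges w)) @^-1`
      (@rV_of_tuple R m @^-1` (@ref_simplex R m)).
    apply/seteqP; split => t /=; rewrite conv_hull_range rV_of_aff -mulmxDl.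
      by move=> h; apply/ref_simplex_bary.
    by move=> /ref_simplex_bary.
  rewrite -[X in measurable X]setTI; apply: measurable_aff => //.
  exact: measurable_ref_simplex.
congr (_ * integral_rV _ _); rewrite conv_hull_range.
apply/seteqP; split => s /=.
  by move=> h; apply/ref_simplex_bary => i; rewrite -lam_param; exact: h.
by move=> /ref_simplex_bary h i; have := h i; rewrite -lam_param.
Qed.

End SimplexGeometry.

Section Divergence.
Variables (R : realType) (n : nat) (w : 'I_n.+2 -> 'rV[R]_n.+1).
Hypothesis uw : edges w \in unitmx.

Definition facet (i : 'I_n.+2) (k : 'I_n.+1) : 'rV[R]_n.+1 := w (lift i k).

Definition facet_int (f : 'rV[R]_n.+1 -> R) (i : 'I_n.+2) : R :=
  ref_int (fun s => f (param (facet i) s)).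

(** The first reference coordinate moves a point of the facet opposite vertex 1 parallel to the edge
    from vertex 0 to vertex 1. *)
Lemma param_line (v : 'I_n.+2 -> 'rV[R]_n.+1) (x : R) (t : 'rV[R]_n) :
  param v (row_mx x%:M t : 'rV_(1 + n)) =
  param (fun k => v (lift (lift ord0 ord0) k)) t
    + x *: (v (lift ord0 ord0) - v ord0).
Proof.
have s0 : (row_mx x%:M t : 'rV[R]_(1 + n)) 0 ord0 = x.
  by have <- : lshift n 0 = ord0 :> 'I_(1 + n); [exact: val_inj|rewrite row_mxEl mxE].
have sS k : (row_mx x%:M t : 'rV[R]_(1 + n)) 0 (lift ord0 k) = t 0 k.
  by have <- : rshift 1 k = lift ord0 k :> 'I_(1 + n); [exact: val_inj|rewrite row_mxEr].
have l0 : lift (lift ord0 ord0) ord0 = ord0 :> 'I_n.+2 by exact: val_inj.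
have lS (k : 'I_n) : lift (lift ord0 ord0) (lift ord0 k) = lift ord0 (lift ord0 k) :> 'I_n.+2.
  exact: val_inj.
rewrite !paramE !big_ord_recl !bary0 baryS big_ord_recl s0 l0.
under eq_bigr do rewrite sS.
have -> : \sum_(i < n) bary (row_mx x%:M t : 'rV[R]_(1 + n)) (lift ord0 (lift ord0 i))
      *: v (lift ord0 (lift ord0 i)) =
    \sum_(i < n) bary t (lift ord0 i) *: v (lift (lift ord0 ord0) (lift ord0 i)).
  by apply: eq_bigr => k _; rewrite !baryS sS lS.
have -> : 1 - (x + \sum_i t 0 i) = 1 - (\sum_i t 0 i) - x by ring.
rewrite scalerBl scalerBr -!addrA; congr (_ + _).
by rewrite addrA (addrC (- _)) [RHS]addrC.
Qed.

(** The far end of each fibre lies on the facet opposite vertex 0. *)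
Lemma param_opposite (v : 'I_n.+2 -> 'rV[R]_n.+1) (t : 'rV[R]_n) :
  param v (row_mx (1 - \sum_j t 0 j)%:M t : 'rV_(1 + n)) =
  param (fun k => v (lift ord0 k)) t.
Proof.
rewrite param_line !paramE !big_ord_recl !bary0.
have -> : lift (lift ord0 ord0) ord0 = ord0 :> 'I_n.+2 by exact: val_inj.
rewrite scalerBr; set a := _ *: v ord0; rewrite addrAC addrCA subrr addr0.
congr (_ + _); apply: eq_bigr => k _; congr (_ *: v _).
exact: val_inj.
Qed.

Lemma ref_int_dirderiv (a b : 'I_n.+2) q : a != b ->
  ref_int (fun s => dirderiv (w a - w b) q (param w s)) =
  facet_int (pev q) b - facet_int (pev q) a.
Proof.
move=> ab; pose l0 : 'I_n.+2 := lift ord0 ord0.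
(* Makes the edge from [b] to [a] the one from vertex 0 to vertex 1: the second transposition sends
   0 to [b], and the first sends 1 to the preimage of [a] under the second. *)
pose sigma : {perm 'I_n.+2} := (tperm l0 (tperm ord0 b a) * tperm ord0 b)%g.
have s1 : sigma l0 = a by rewrite permM tpermL tpermK.
have s0 : sigma ord0 = b.
  have c0 : tperm ord0 b a != ord0.
    by rewrite -(inj_eq (@perm_inj _ (tperm ord0 b))) tpermK tpermL.
  by rewrite permM [tperm l0 _ _]tpermD// tpermL.
pose v i := w (sigma i).
rewrite -(ref_int_reorder w sigma (polyfun_dirderiv _ _)) -/v.
rewrite (@ref_int_derivative _ _ (fun s => pev q (param v s))).
- under [X in ref_int X]eq_fun do rewrite param_opposite.
  rewrite (_ : (fun _ => _) = fun t =>
      pev q (param (fun k => v (lift ord0 k)) t) - pev q (param (fun k => v (lift l0 k)) t)).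
    rewrite ref_intB; try by apply: polyfun_param; exact: polyfun_pev.
    have iw := vertex_inj uw.
    have rE (k : 'I_n.+2) : ref_int (fun t => pev q (param (fun i : 'I_n.+1 => v (lift k i)) t)) =
        facet_int (pev q) (sigma k).
      apply: (@ref_int_range _ _ _ (fun i : 'I_n.+1 => v (lift k i)) (facet (sigma k)) (pev q)).
      - exact: polyfun_pev.
      - by move=> i i' /iw/perm_inj/lift_inj.
      - by move=> i i' /iw/lift_inj.
      - by rewrite range_reorder_lift -range_lift.
    by rewrite !rE s0 s1.
  apply/funext => t; rewrite (_ : 0 = 0%:M); last by rewrite raddf0.
  by rewrite param_line scale0r addr0.
- by apply: polyfun_param; exact: polyfun_pev.
- by apply: polyfun_param; exact: polyfun_dirderiv.
- move=> t; have [P hP] := line_poly q (param (fun k => v (lift l0 k)) t) (w a - w b).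
  by exists P => x; rewrite param_line /v s0 s1 -!(hP x).1 (hP x).2.
Qed.

(** The coordinate direction is a combination of the edges from vertex 0, and each edge derivative
    integrates to a difference of two facet integrals. Since all gradients sum to zero, the
    coefficients collected on the facet opposite vertex 0 add up to minus its own gradient. *)
Lemma divergence_simplex_grad j q :
  integral_rV (conv_hull (range w)) (pev (mpoly.mderiv j q)) =
  - `|\det (edges w)| * \sum_i grad w i 0 j * facet_int (pev q) i.
Proof.
rewrite integral_simplex//; last exact: polyfun_pev.
rewrite mulNr -mulrN; congr (_ * _).
have gradE i : grad w i 0 j = dotp (grad w i) (delta_mx 0 j) by rewrite dotp_delta.
have sum0 : \sum_i grad w i 0 j = 0.
  by rewrite -[RHS](sum_grad w (delta_mx 0 j)); apply: eq_bigr => i _; rewrite gradE.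
have dE : delta_mx 0 j = \sum_(i < n.+1) grad w (lift ord0 i) 0 j *: (w (lift ord0 i) - w ord0).
  rewrite -[LHS](gradK uw) big_ord_recl.
  under [RHS]eq_bigr do rewrite scalerBr.
  rewrite sumrB -scaler_suml -gradE addrC; congr (_ + _).
    by apply: eq_bigr => i _; rewrite gradE.
  rewrite -scaleNr; congr (_ *: _); apply/eqP; rewrite -subr_eq0 opprK.
  by move: sum0; rewrite big_ord_recl => ->.
have dirE x : pev (mpoly.mderiv j q) x = \sum_(i < n.+1)
    grad w (lift ord0 i) 0 j * dirderiv (w (lift ord0 i) - w ord0) q x.
  rewrite -dirderiv_delta dE; elim/big_rec2 : _ => [|i y h _ <-].
    by rewrite -(scale0r (0 : 'rV_n.+1)) dirderivZ mul0r.
  by rewrite [LHS]dirderivD dirderivZ.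
under [X in ref_int X]eq_fun do rewrite dirE.
rewrite ref_int_sum; last first.
  by move=> i; apply: polyfunZ; apply: polyfun_param; exact: polyfun_dirderiv.
rewrite [in RHS]big_ord_recl opprD -sumrN.
rewrite (eq_bigr (fun i => grad w (lift ord0 i) 0 j * facet_int (pev q) ord0 +
   - (grad w (lift ord0 i) 0 j * facet_int (pev q) (lift ord0 i)))); last first.
  move=> i _; rewrite ref_intZ; last by apply: polyfun_param; exact: polyfun_dirderiv.
  by rewrite ref_int_dirderiv// mulrBr.
rewrite big_split/= -mulr_suml; congr (_ + _); rewrite -mulNr; congr (_ * _).
by apply/eqP; rewrite -subr_eq0 opprK addrC; move: sum0; rewrite big_ord_recl => ->.
Qed.

(** The square of volume equals base times height, the height over facet [i] being the inverse of
    the length of [grad w i]. The vertices are reordered so that [i] comes second: the facet edges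
    are then the edge matrix without its first row, on which [grad w i] takes the value 1. *)
Lemma det_gram_facet i :
  \det (edges (facet i) *m (edges (facet i))^T) =
  dotp (grad w i) (grad w i) * \det (edges w) ^+ 2.
Proof.
have [b bi] : exists b : 'I_n.+2, b != i by exists (lift i ord0); rewrite eq_sym neq_lift.
pose l0 : 'I_n.+2 := lift ord0 ord0.
pose sigma : {perm 'I_n.+2} := (tperm l0 (tperm ord0 b i) * tperm ord0 b)%g.
have s1 : sigma l0 = i by rewrite permM tpermL tpermK.
have s0 : sigma ord0 = b.
  have c0 : tperm ord0 b i != ord0.
    by rewrite -(inj_eq (@perm_inj _ (tperm ord0 b))) tpermK tpermL eq_sym.
  by rewrite permM [tperm l0 _ _]tpermD// tpermL.
pose v k := w (sigma k).
have iw := vertex_inj uw.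
have [tau E] := @same_range_reorder n.+1 _ (facet i) (fun k : 'I_n.+1 => v (lift l0 k))
  (fun k k' h => lift_inj (iw _ _ h)) (fun k k' h => lift_inj (perm_inj (iw _ _ h)))
  (esym (etrans (range_reorder_lift w sigma l0)
    (etrans (congr1 (fun x => [set w j | j in [set j | j != x]]) s1)
    (esym (range_lift w i))))).
rewrite (funext E) (det_gram_reorder (fun k : 'I_n.+1 => v (lift l0 k)) tau).
have dv : `|\det (edges v)| = `|\det (edges w)| by exact: abs_det_edges_reorder.
have uv : edges v \in unitmx.
  by move: uw; rewrite !unitmxE !unitfE -!normr_gt0 dv.
have dF : edges (fun k : 'I_n.+1 => v (lift l0 k)) = dsubmx (edges v : 'M[R]_(1 + n, _)).
  apply/matrixP => k j; rewrite !mxE.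
  by congr (v _ _ _ - v _ _ _); exact: val_inj.
rewrite dF (@det_gram_complement R n (edges v) (grad w i))//.
  by rewrite -(real_normK (num_real (\det (edges v)))) dv real_normK// num_real.
apply/matrixP => k j; rewrite ord1.
have -> : (edges v *m (grad w i)^T) k 0 = dotp (grad w i) (v (lift ord0 k) - v ord0).
  by rewrite dotpC dotpE -row_edges -row_mul [RHS]mxE.
rewrite dotp_grad_sub !(lam_vertex uw) -s1 !(inj_eq perm_inj) subr0 mxE andbT.
by rewrite (inj_eq lift_inj) eq_sym.
Qed.

Lemma grad_neq0 i : grad w i != 0.
Proof.
have [b bi] : exists b : 'I_n.+2, i != b by exists (lift i ord0); rewrite neq_lift.
apply/eqP => g0; have := dotp_grad_sub w i (w i) (w b).
rewrite g0 !(lam_vertex uw) eqxx (negbTE bi) subr0 dotpC -(scale0r (0 : 'rV_n.+1)) dotpZr mul0r.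
by move/eqP; rewrite eq_sym oner_eq0.
Qed.

Lemma outward_normalP i : is_outward_normal w i (outward_normal w i).
Proof.
have g0 := dotp_gt0 (grad_neq0 i).
suff H : is_outward_normal w i (- (Num.sqrt (dotp (grad w i) (grad w i)))^-1 *: grad w i).
  exact: (@getPex _ [set nu | is_outward_normal w i nu] (ex_intro _ _ H)).
split.
- rewrite dotpZl dotpZr mulrA mulrNN -invfM -expr2 sqr_sqrtr ?(ltW g0)//.
  by rewrite mulVf// gt_eqF.
- move=> j k ji ki; rewrite dotpZl dotp_grad_sub !(lam_vertex uw).
  by rewrite eq_sym (negbTE ji) eq_sym (negbTE ki) subrr mulr0.
- move=> j ji; rewrite dotpZl dotp_grad_sub !(lam_vertex uw) eqxx eq_sym (negbTE ji).
  by rewrite subr0 mulr1 oppr_lt0 invr_gt0 sqrtr_gt0.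
Qed.

(** By [gradK], the product of [nu] with a vector [h] is a sum over vertices weighted by the
    derivatives of [lam] along [h]. These weights sum to zero, so [w b] may be subtracted from every
    vertex, which leaves only the term of [i]. *)
Lemma facet_normalE i nu :
  (forall j k, j != i -> k != i -> dotp nu (w j - w k) = 0) ->
  forall b, b != i -> nu = dotp nu (w i - w b) *: grad w i.
Proof.
move=> nf b bi.
apply/rowP => j; rewrite -dotp_delta [in RHS]mxE -[in RHS]dotp_delta.
set h := delta_mx 0 j; rewrite -[in LHS](gradK uw h).
have -> : dotp nu (\sum_k dotp (grad w k) h *: w k) =
    \sum_k dotp (grad w k) h * dotp nu (w k).
  elim/big_rec2 : _ => [|k y x _ <-]; last by rewrite dotpDr dotpZr.
  by rewrite -(scale0r (0 : 'rV_n.+1)) dotpZr mul0r.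
have sum0 : \sum_k dotp (grad w k) h * dotp nu (w b) = 0.
  by rewrite -mulr_suml sum_grad mul0r.
rewrite -[LHS]subr0 -[X in _ - X]sum0 -sumrB.
rewrite (bigD1 i)//= big1 => [|k ki]; last by rewrite -mulrBr -dotpBr nf// mulr0.
by rewrite addr0 -mulrBr -dotpBr mulrC.
Qed.

(** Orthogonality leaves a multiple of the gradient, unit length fixes the factor up to sign, and
    outwardness fixes the sign. *)
Lemma is_outward_normalE i nu : is_outward_normal w i nu ->
  nu = - (Num.sqrt (dotp (grad w i) (grad w i)))^-1 *: grad w i.
Proof.
move=> [n1 nf no].
have [b bi] : exists b : 'I_n.+2, b != i by exists (lift i ord0); rewrite eq_sym neq_lift.
have nuE := facet_normalE nf bi.
have k0 : dotp nu (w i - w b) < 0 by exact: no.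
have g0 := dotp_gt0 (grad_neq0 i).
rewrite {1}nuE; congr (_ *: _); apply: (@mulIf _ (Num.sqrt (dotp (grad w i) (grad w i)))).
  by rewrite gt_eqF// sqrtr_gt0.
rewrite mulNr mulVf ?gt_eqF ?sqrtr_gt0//.
set kappa := dotp nu _ in nuE k0 *.
have : (- kappa * Num.sqrt (dotp (grad w i) (grad w i))) ^+ 2 = 1 ^+ 2.
  rewrite exprMn sqrrN sqr_sqrtr ?ltW// expr1n -n1 nuE dotpZl dotpZr; ring.
move=> /eqP; rewrite eqrXn2// ?mulr_ge0 ?sqrtr_ge0 ?oppr_ge0 ?ltW// => /eqP.
by move=> h; rewrite -h; ring.
Qed.

Lemma outward_normalE i :
  outward_normal w i = - (Num.sqrt (dotp (grad w i) (grad w i)))^-1 *: grad w i.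
Proof. exact: is_outward_normalE (outward_normalP i). Qed.

Lemma outward_normal_unique i nu :
  is_outward_normal w i nu -> nu = outward_normal w i.
Proof. by rewrite outward_normalE; exact: is_outward_normalE. Qed.

(** The length of the gradient in the area element cancels the normalization of the normal. *)
Lemma surface_integral_normal i f j :
  surface_integral (facet i) f * outward_normal w i 0 j =
  - `|\det (edges w)| * (grad w i 0 j * facet_int f i).
Proof.
have g0 := dotp_gt0 (grad_neq0 i).
rewrite surface_integralE det_gram_facet sqrtrM ?(ltW g0)// sqrtr_sqr.
rewrite outward_normalE mxE /facet_int.
set s := Num.sqrt _; have s0 : s != 0 by rewrite gt_eqF// sqrtr_gt0.
by field.
Qed.

Lemma divergence_simplex j q :
  integral_rV (conv_hull (range w)) (pev (mpoly.mderiv j q)) =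
  \sum_i surface_integral (facet i) (pev q) * outward_normal w i 0 j.
Proof.
rewrite divergence_simplex_grad mulr_sumr; apply: eq_bigr => i _.
by rewrite surface_integral_normal.
Qed.

End Divergence.

(** * The mass matrix *)

Section Positivity.
Variable R : realType.
Local Notation RR := (measurableTypeR R).

(** The bound on [t] ensures [t * |b i| < a i] for every [i]; the added 1 keeps it defined when all
    [b i] vanish. *)
Lemma affine_gt0_near0 (I : finType) (a b : I -> R) : (forall i, 0 < a i) ->
  exists2 e : R, 0 < e & forall t, 0 < t < e -> forall i, 0 < a i + t * b i.
Proof.
move=> a0; pose S := \sum_i `|b i| / a i.
have S0 : 0 <= S by apply: sumr_ge0 => i _; rewrite divr_ge0// ltW.
exists (1 + S)^-1; first by rewrite invr_gt0 ltr_pwDl.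
move=> t /andP[t0 tS] i.
have bS : `|b i| / a i <= S.
  by rewrite /S (bigD1 i)//= lerDl sumr_ge0// => k _; rewrite divr_ge0// ltW.
have tS1 : t * (1 + S) < 1 by rewrite -ltr_pdivlMr ?ltr_pwDl// div1r.
have : t * (`|b i| / a i) < 1.
  by apply: le_lt_trans tS1; rewrite ler_pM2l//; lra.
rewrite mulrA ltr_pdivrMr// mul1r => tb.
have : 0 <= t * (b i + `|b i|).
  rewrite mulr_ge0 ?(ltW t0)//; have := ler_norm (- b i); rewrite normrN; lra.
by rewrite mulrDr; lra.
Qed.

Lemma bary_polyfun m (i : 'I_m.+1) : polyfun (fun s : 'rV[R]_m => bary s i).
Proof.
case: (unliftP ord0 i) => [j|] ->.
  by under eq_fun do rewrite baryS; exact: polyfun_coord.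
under eq_fun do rewrite bary0 -mulN1r.
apply: polyfunD; first exact: polyfun_cst.
by apply: polyfunZ; apply: polyfun_sum => j; exact: polyfun_coord.
Qed.

Lemma polyfun_gt0_near m (I : finType) (f : I -> 'rV[R]_m -> R) x :
  (forall i, polyfun (f i)) -> (forall i, 0 < f i x) ->
  \forall y \near x, forall i, 0 < f i y.
Proof.
move=> pf fx; apply: (@filter_forall _ I (fun i y => 0 < f i y) (nbhs x)) => i.
have cf : f i y @[y --> x] --> f i x by exact: polyfun_continuous.
by apply: (cvgr_gt (f i x)).
Qed.

(** Near [s] the integrand exceeds half its value there and a cube fits in the reference simplex;
    [leb_box] computes the measure of that cube. *)
Lemma ref_int_gt0 m (f : 'rV[R]_m -> R) s : polyfun f -> (forall x, 0 <= f x) ->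
  (forall i, 0 < bary s i) -> 0 < f s -> 0 < ref_int f.
Proof.
move=> pf f0 bs fs; pose c := f s / 2.
have c0 : 0 < c by rewrite divr_gt0.
(* One finite family for all conditions: [None] bounds [f] from below, and [Some i] keeps a
   barycentric coordinate positive. *)
pose g (o : option 'I_m.+1) x := if o is Some i then bary x i else f x - c.
have pg o : polyfun (g o).
  case: o => [i|]; first exact: bary_polyfun.
  by apply: polyfunD => //; exact: polyfun_cst.
have gs o : 0 < g o s.
  case: o => [i|]; first exact: bs.
  rewrite /g /c; lra.
have /nbhs_ballP[e e0 he] := polyfun_gt0_near pg gs.
pose A i : set RR := `]s 0 i - e, s 0 i + e[%classic.
pose box := [set t : m.-tuple RR | forall i, A i (tnth t i)].
have boxP t : box t -> f (rV_of_tuple t) > c /\ ref_simplex (rV_of_tuple t).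
  move=> bt; have hb : ball s e (rV_of_tuple t).
    split=> // i j; rewrite ord1 mxE; have := bt j.
    by rewrite /A/= in_itv/= /ball/= ltr_distlC.
  have h := he _ hb; split; first by have := h None; rewrite /g subr_gt0.
  by apply/ref_simplex_bary => i; apply: ltW; exact: (h (Some i)).
have mbox : measurable box.
  rewrite (_ : box = \bigcap_(i in [set: 'I_m]) ((fun t => tnth t i) @^-1` A i)).
    apply: fin_bigcap_measurable => // i _.
    rewrite -[X in measurable X]setTI; apply: measurable_tnth => //.
    exact: measurable_itv.
  by apply/seteqP; split => t /= h; [move=> i _; exact: h | move=> i; exact: h].
have vbox : @sigma_leb R m box = ((e *+ 2) ^+ m)%:E.
  rewrite /sigma_leb leb_box; last by move=> i; exact: measurable_itv.
  rewrite (eq_bigr (fun=> (e *+ 2)%:E)) => [|i _].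
    by rewrite prodEFin prodr_const card_ord.
  have ee : 0 < e by [].
  rewrite lebesgue_measure_itv/= lte_fin ifT -?EFinD; last by lra.
  by congr (_%:E); rewrite mulr2n; ring.
have mf : measurable_fun setT (fun t : m.-tuple RR => f (rV_of_tuple t)).
  exact: polyfun_measurable.
have mref := @measurable_ref_simplex R m.
have fint := polyfun_integrable pf.
rewrite /ref_int /integral_rV /Rintegral fine_gt0//; apply/andP; split; last first.
  exact: integrable_lty.
apply: (@lt_le_trans _ _ (\int[@sigma_leb R m]_(t in box) (f (rV_of_tuple t))%:E)%E).
  apply: (@lt_le_trans _ _ (\int[@sigma_leb R m]_(t in box) c%:E)%E).
    rewrite integral_cst// [X in (_ * X)%E]vbox -EFinM lte_fin mulr_gt0// exprn_gt0//.
    by rewrite mulrn_wgt0.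
  apply: ge0_le_integral => //.
  - by move=> t _; rewrite lee_fin ltW.
  - by apply/measurable_EFinP; exact: measurable_funTS.
  - by move=> t /boxP[/ltW].
apply: ge0_subset_integral => //.
- by apply/measurable_EFinP; exact: measurable_funTS.
- by move=> t _; rewrite lee_fin.
- by move=> t /boxP[].
Qed.

Lemma barycenter_gt0 m i : 0 < bary (const_mx (m.+1%:R^-1) : 'rV[R]_m) i.
Proof.
have m0 : 0 < m.+1%:R :> R by rewrite ltr0n.
case: (unliftP ord0 i) => [j|] ->; first by rewrite baryS mxE invr_gt0.
rewrite bary0 (eq_bigr (fun=> m.+1%:R^-1)) => [|j _]; last by rewrite mxE.
rewrite sumr_const card_ord -[_ *+ m]mulr_natl subr_gt0 ltr_pdivrMr// mul1r ltr_nat.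
by [].
Qed.

(** A segment from the barycenter to any point starts in the interior, so vanishing propagates to
    the whole space. *)
Lemma pev_eq0_interior m (w : 'I_m.+1 -> 'rV[R]_m) q : edges w \in unitmx ->
  (forall x, (forall i, 0 < lam w x i) -> pev q x = 0) -> q = 0.
Proof.
move=> uw h; apply: pev_eq0 => z.
pose y := param w (const_mx m.+1%:R^-1).
have ly i : 0 < lam w y i by rewrite lam_param// barycenter_gt0.
have [e e0 he] := affine_gt0_near0 (fun i => dotp (grad w i) (z - y)) ly.
have := @pev_line_eq R m q 0 0 y z e e0; rewrite addr0 => ->.
  exact: mpoly.meval0.
move=> t te; rewrite [RHS]mpoly.meval0; apply: h => i.
by rewrite lamD dotpZr; exact: he.
Qed.

Lemma integral_simplex_sqr_ge0 m (w : 'I_m.+1 -> 'rV[R]_m) q : edges w \in unitmx ->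
  0 <= integral_rV (conv_hull (range w)) (pev (q * q)).
Proof.
move=> uw; rewrite /integral_rV /Rintegral fine_ge0//; apply: integral_ge0 => t _.
by rewrite lee_fin pevM -expr2 sqr_ge0.
Qed.

Lemma integral_simplex_sqr_eq0 m (w : 'I_m.+1 -> 'rV[R]_m) q : edges w \in unitmx ->
  integral_rV (conv_hull (range w)) (pev (q * q)) = 0 -> q = 0.
Proof.
move=> uw; rewrite integral_simplex//; last exact: polyfun_pev.
have dw : 0 < `|\det (edges w)| by rewrite normr_gt0 -unitfE -unitmxE.
move=> /eqP; rewrite mulf_eq0 gt_eqF//= => /eqP q2.
apply: (pev_eq0_interior uw) => x hx; apply/eqP; apply: contraT => qx.
suff : 0 < ref_int (fun s => pev (q * q) (param w s)) by rewrite q2 ltxx.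
apply: (@ref_int_gt0 _ _ (coords w x)) => //.
- by apply: polyfun_param; exact: polyfun_pev.
- by move=> s; rewrite pevM -expr2 sqr_ge0.
- by rewrite coordsK// pevM -expr2 lt_def sqrf_eq0 qx sqr_ge0.
Qed.

End Positivity.

(** * Integral forms on piecewise polynomials *)

Section BrokenForms.
Variables (R : realType) (d' : nat) (K : finType) (M : mesh R d' K).
Hypothesis hM : is_mesh M.
Local Notation d := d'.+1.
Local Notation broken := (broken R d' K).

Let uvtx k : edges (vtx M k) \in unitmx := vtx_nondegenerate hM k.

Definition bmul (u v : broken) : broken := [ffun k => u k * v k].
Definition bderiv (j : 'I_d) (u : broken) : broken := [ffun k => mpoly.mderiv j (u k)].
Definition bform (u v : broken) : R := broken_integral M (bmul u v).

Lemma integral_elt k (q : mpoly.mpoly d R) :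
  integral_rV (elt M k) (peval q) =
  `|\det (edges (vtx M k))| * ref_int (fun s => pev q (param (vtx M k) s)).
Proof. by apply: (integral_simplex (uvtx k)); exact: polyfun_pev. Qed.

Lemma broken_integralD u v :
  broken_integral M (u + v) = broken_integral M u + broken_integral M v.
Proof.
rewrite -big_split; apply: eq_bigr => k _ /=; rewrite ffunE !integral_elt -mulrDr.
congr (_ * _); rewrite -ref_intD; try by apply: polyfun_param; exact: polyfun_pev.
by congr ref_int; apply/funext => s; rewrite pevD.
Qed.

Lemma broken_integralZ c u : broken_integral M (c *: u) = c * broken_integral M u.
Proof.
rewrite /broken_integral mulr_sumr; apply: eq_bigr => k _.
rewrite ffunE !integral_elt mulrCA; congr (_ * _).
rewrite -ref_intZ; last by apply: polyfun_param; exact: polyfun_pev.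
by congr ref_int; apply/funext => s; rewrite pevZ.
Qed.

Lemma bformC u v : bform u v = bform v u.
Proof. by congr broken_integral; apply/ffunP => k; rewrite !ffunE mulrC. Qed.

Lemma bformDr u v v' : bform u (v + v') = bform u v + bform u v'.
Proof.
rewrite -broken_integralD; congr broken_integral; apply/ffunP => k.
by rewrite !ffunE mulrDr.
Qed.

Lemma bformZr c u v : bform u (c *: v) = c * bform u v.
Proof.
rewrite -broken_integralZ; congr broken_integral; apply/ffunP => k.
by rewrite !ffunE scalerAr.
Qed.

Lemma bform_sumr (I : Type) (r : seq I) (a : I -> R) (b : I -> broken) u :
  bform u (\sum_(i <- r) a i *: b i) = \sum_(i <- r) a i * bform u (b i).
Proof.
elim/big_rec2 : _ => [|i y v _ <-]; last by rewrite bformDr bformZr.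
by rewrite -(scale0r (0 : broken)) bformZr mul0r.
Qed.

Lemma bform_suml (I : Type) (r : seq I) (a : I -> R) (b : I -> broken) u :
  bform (\sum_(i <- r) a i *: b i) u = \sum_(i <- r) a i * bform (b i) u.
Proof. by rewrite bformC bform_sumr; apply: eq_bigr => i _; rewrite bformC. Qed.

Lemma bform_eq0 u : bform u u = 0 -> u = 0.
Proof.
move=> u0; apply/ffunP => k; rewrite ffunE.
apply: (integral_simplex_sqr_eq0 (uvtx k)).
have := @psumr_eq0P _ _ (fun k => true) (fun k => integral_rV (elt M k) (pev (u k * u k))).
apply=> // [l _|]; first exact: (integral_simplex_sqr_ge0 _ (uvtx l)).
by rewrite -[RHS]u0; apply: eq_bigr => l _; rewrite ffunE.
Qed.

Lemma bderiv_sum (I : Type) (r : seq I) (a : I -> R) (b : I -> broken) j :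
  bderiv j (\sum_(i <- r) a i *: b i) = \sum_(i <- r) a i *: bderiv j (b i).
Proof.
apply/ffunP => k; rewrite ffunE !sum_ffunE raddf_sum; apply: eq_bigr => i _.
by rewrite !ffunE /= mpoly.mderivZ.
Qed.

Lemma bderiv_DG N j u : DG N.+1 u -> DG N (bderiv j u).
Proof.
move=> hu k; rewrite ffunE; apply: leq_trans (msize_mderiv j (u k)) _.
by have := hu k; case: (mpoly.msize (u k)).
Qed.

Lemma DG_sum N (I : Type) (r : seq I) (a : I -> R) (b : I -> broken) :
  (forall i, DG N (b i)) -> DG N (\sum_(i <- r) a i *: b i).
Proof.
move=> hb k; rewrite sum_ffunE; elim/big_rec : _ => [|i q _ hq].
  by rewrite mpoly.msize0.
apply: leq_trans (mpoly.msizeD_le _ _) _; rewrite geq_max hq andbT ffunE.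
exact: leq_trans (mpoly.msizeZ_le _ _) (hb i k).
Qed.

Variables (N nc np : nat) (phi : 'I_nc -> broken) (psi : 'I_np -> broken).
Hypothesis hphi : is_basis (DG N) phi.

(** A Gram matrix: a kernel vector gives a combination of the [phi c] of zero square integral, hence
    zero, and coordinates in a basis are unique. *)
Lemma Dmat_unit : Dmat M phi \in unitmx.
Proof.
rewrite -row_free_unit -kermx_eq0; apply/eqP/row_matrixP => i; rewrite row0.
have : row i (kermx (Dmat M phi)) *m Dmat M phi = 0.
  by rewrite -row_mul mulmx_ker row0.
set v := row i _ => vD.
pose u : broken := \sum_c v 0 c *: phi c.
have uu : bform u u = 0.
  rewrite bform_sumr big1// => c _; rewrite bform_suml.
  have := congr1 (fun A : 'rV_nc => A 0 c) vD; rewrite mxE mxE => h.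
  rewrite [X in _ * X](_ : _ = 0) ?mulr0// -[RHS]h.
  by apply: eq_bigr => a _; rewrite [Dmat M phi a c]mxE.
have [_ /(_ 0)[]] := hphi; first by move=> k; rewrite ffunE mpoly.msize0.
move=> a [_ ha].
have av : a = [ffun c => v 0 c].
  by apply: ha; rewrite -[LHS](bform_eq0 uu); apply: eq_bigr => c _; rewrite ffunE.
have a0 : a = [ffun=> 0].
  by apply: ha; rewrite big1// => c _; rewrite ffunE scale0r.
apply/rowP => c; have := congr1 (fun f : {ffun _ -> R} => f c) av.
by rewrite a0 !ffunE => <-; rewrite mxE.
Qed.

Lemma nablas_bform (Z : 'I_np -> R) p j k : (forall q, DG N.+1 (psi q)) ->
  \sum_(c < nc) \sum_(q < np)
    dual_nabla M phi psi j p c * primary_nabla M phi psi k c q * Z q =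
  - bform (bderiv k (\sum_q Z q *: psi q)) (bderiv j (psi p)).
Proof.
move=> hpsi; set Zh := \sum_q Z q *: psi q.
have hZ : DG N (bderiv k Zh) by apply: bderiv_DG; exact: DG_sum.
have [_ /(_ _ hZ)[a [aE _]]] := hphi.
rewrite aE bform_suml -sumrN; apply: eq_bigr => c _.
have -> : bform (phi c) (bderiv j (psi p)) = Kten M phi psi j c p.
  by rewrite mxE; congr broken_integral; apply/ffunP => l; rewrite !ffunE.
under eq_bigr do rewrite -mulrA.
rewrite -mulr_sumr /dual_nabla mulNr mulrC; congr (- (_ * _)).
(* Testing the expansion of the derivative of [Zh] against [phi b], so that the inverse mass matrix
   recovers its coefficients [a]. *)
have KE b : \sum_q Kten M phi psi k b q * Z q = \sum_e Dmat M phi b e * a e.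
  transitivity (bform (phi b) (bderiv k Zh)).
    rewrite bderiv_sum bform_sumr; apply: eq_bigr => q _; rewrite mxE mulrC.
    by congr (_ * broken_integral _ _); apply/ffunP => l; rewrite !ffunE.
  by rewrite aE bform_sumr; apply: eq_bigr => e _; rewrite [Dmat M phi b e]mxE mulrC.
transitivity ((invmx (Dmat M phi) *m (Dmat M phi *m \col_e a e)) c 0).
  rewrite mxE /primary_nabla; under eq_bigr do rewrite mulr_suml.
  rewrite exchange_big; apply: eq_bigr => b _.
  under eq_bigr do rewrite -mulrA.
  rewrite -mulr_sumr KE; congr (_ * _); rewrite mxE.
  by apply: eq_bigr => e _; rewrite [(\col_e a e) e 0]mxE.
by rewrite mulKmx ?Dmat_unit// mxE.
Qed.

End BrokenForms.

(** * Facets shared by two simplices *)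

Section FacetGeometry.
Variables (R : realType) (n : nat).
Implicit Types (w : 'I_n.+2 -> 'rV[R]_n.+1) (i : 'I_n.+2).

Lemma lam_polyfun w i : polyfun (fun x => lam w x i).
Proof.
rewrite (_ : (fun _ => _) = fun x =>
  bary (- w ord0 *m invmx (edges w) + x *m invmx (edges w)) i).
  exact: (polyfun_affine _ _ (bary_polyfun R i)).
by apply/funext => x; rewrite /lam /coords mulmxDl addrC.
Qed.

Lemma interior_simplex w x : edges w \in unitmx -> (forall i, 0 < lam w x i) ->
  interior (conv_hull (range w)) x.
Proof.
move=> uw hx; rewrite conv_hull_range//.
apply: filterS (polyfun_gt0_near (lam_polyfun w) hx).
by move=> y hy i; apply: ltW; exact: hy.
Qed.

Lemma open_segment (D : set 'rV[R]_n.+1) x v : open D -> D x ->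
  exists2 e : R, 0 < e & forall t, 0 < t < e -> D (x + t *: v).
Proof.
move=> oD Dx; have /nbhs_ballP[r r0 hr] : nbhs x D by exact: open_nbhs_nbhs.
have r0' : 0 < r by [].
(* Balls are cubes here, so staying in one amounts to two affine inequalities per coordinate; the
   boolean selects the sign. *)
have [e e0 he] := @affine_gt0_near0 _ ('I_n.+1 * bool)%type (fun=> r)
  (fun kb => if kb.2 then v 0 kb.1 else - v 0 kb.1) (fun=> r0').
exists e => // t te; apply: hr; split=> // a b; rewrite !mxE /ball/= ord1.
rewrite opprD addrA subrr add0r normrN ltr_norml.
by have := he t te (b, true); have := he t te (b, false) => /=; lra.
Qed.

Lemma lam_param_facet w i s j : edges w \in unitmx ->
  lam w (param (facet w i) s) j = \sum_k bary s k * (j == lift i k)%:R.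
Proof.
move=> uw; rewrite (_ : facet w i = fun k => param w (ref_vertex R (lift i k))).
  rewrite param_comp lam_param// bary_param; apply: eq_bigr => k _.
  by rewrite bary_ref_vertex.
by apply/funext => k; rewrite param_ref_vertex.
Qed.

Lemma lam_param_facet0 w i s : edges w \in unitmx ->
  lam w (param (facet w i) s) i = 0.
Proof.
move=> uw; rewrite lam_param_facet// big1// => k _.
by rewrite (negbTE (neq_lift i k)) mulr0.
Qed.

Definition facet_center w i : 'rV[R]_n.+1 := n.+1%:R^-1 *: \sum_k facet w i k.

Lemma facet_centerE w i :
  facet_center w i = param (facet w i) (const_mx n.+1%:R^-1).
Proof.
rewrite paramE /facet_center scaler_sumr; apply: eq_bigr => k _; congr (_ *: _).
case: (unliftP ord0 k) => [l|] ->; first by rewrite baryS mxE.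
rewrite bary0 (eq_bigr (fun=> n.+1%:R^-1)) => [|j _]; last by rewrite mxE.
rewrite sumr_const card_ord -[_ *+ n]mulr_natl -natr1; field.
by rewrite natr1 pnatr_eq0.
Qed.

Lemma facet_center0 w i : edges w \in unitmx -> lam w (facet_center w i) i = 0.
Proof. by move=> uw; rewrite facet_centerE lam_param_facet0. Qed.

Lemma facet_center_gt0 w i k : edges w \in unitmx -> k != i ->
  0 < lam w (facet_center w i) k.
Proof.
move=> uw; rewrite eq_sym => ki; rewrite facet_centerE lam_param_facet//.
case: (unliftP i k) ki => [l|] ->; last by rewrite eqxx.
move=> _; rewrite (bigD1 l)//= eqxx mulr1 big1 ?addr0 => [|j jl].
  exact: barycenter_gt0.
by rewrite (inj_eq lift_inj) eq_sym (negbTE jl) mulr0.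
Qed.

Lemma facet_inj w i : edges w \in unitmx -> injective (facet w i).
Proof. by move=> uw k l /(vertex_inj uw)/lift_inj. Qed.

Lemma facet_center_range w w' i i' : edges w \in unitmx -> edges w' \in unitmx ->
  range (facet w i) = range (facet w' i') -> facet_center w i = facet_center w' i'.
Proof.
move=> uw uw' r.
have [sigma E] := same_range_reorder (@facet_inj w i uw) (@facet_inj w' i' uw') r.
rewrite /facet_center [in RHS](reindex_inj (@perm_inj _ sigma)); congr (_ *: _).
by apply: eq_bigr => k _; rewrite E.
Qed.

Lemma outward_normal_grad w i : edges w \in unitmx ->
  exists2 c, c < 0 & outward_normal w i = c *: grad w i.
Proof.
move=> uw; exists (- (Num.sqrt (dotp (grad w i) (grad w i)))^-1).
  by rewrite oppr_lt0 invr_gt0 sqrtr_gt0 dotp_gt0// grad_neq0.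
exact: outward_normalE.
Qed.

(* Two simplices on the same side of a common facet overlap near its center. *)
Lemma opposite_normal w w' i i' : edges w \in unitmx -> edges w' \in unitmx ->
  range (facet w i) = range (facet w' i') ->
  interior (conv_hull (range w)) `&` interior (conv_hull (range w')) = set0 ->
  outward_normal w' i' = - outward_normal w i.
Proof.
move=> uw uw' r disj; set nu := outward_normal w i.
have [c c0 nuE] := @outward_normal_grad w i uw.
have [n1 nf no] := outward_normalP uw i; rewrite -/nu in n1 nf no nuE.
have nf' j k : j != i' -> k != i' -> dotp nu (w' j - w' k) = 0.
  move=> ji ki.
  have ex l : l != i' -> exists2 a, a != i & w' l = w a.
    move=> li; have : range (facet w' i') (w' l) by rewrite range_lift; exists l.
    by rewrite -r range_lift => -[a ai <-]; exists a.
  have [a ai ->] := ex j ji; have [b bi ->] := ex k ki; exact: nf.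
have [b bi] : exists b : 'I_n.+2, b != i' by exists (lift i' ord0); rewrite eq_sym neq_lift.
have nuE' := facet_normalE uw' nf' bi.
set kappa := dotp nu (w' i' - w' b) in nuE'.
(* The sign of [kappa] tells on which side of the facet [w'] lies: zero contradicts unit length, a
   positive value makes [- nu] outward for [w'], and a negative one makes the two simplices
   overlap. *)
have [k0|k0|k0] := ltgtP kappa 0; last first.
- move: n1; rewrite nuE' k0 scale0r -(scale0r (0 : 'rV_n.+1)) dotpZl mul0r.
  by move/eqP; rewrite eq_sym oner_eq0.
- apply/esym/outward_normal_unique => //; split.
  + by rewrite -scaleN1r dotpZl dotpZr n1; ring.
  + by move=> j k ji ki; rewrite -scaleN1r dotpZl nf'// mulr0.
  + move=> j ji; rewrite -scaleN1r dotpZl mulN1r oppr_lt0.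
    by rewrite -(subrK (w' b) (w' i')) -addrA dotpDr (nf' b j)// addr0.
exfalso; pose y := facet_center w i.
have yE : y = facet_center w' i' by exact: facet_center_range.
(* Moving from the facet center along [- nu] increases the coordinate of [m] from 0 and keeps the
   other ones positive for a short while. The value 1 is a placeholder at [m], which is treated
   apart. *)
have inside (v : 'I_n.+2 -> 'rV[R]_n.+1) m d : edges v \in unitmx ->
    y = facet_center v m -> d < 0 -> nu = d *: grad v m ->
    exists2 e, 0 < e & forall t, 0 < t < e -> forall k, 0 < lam v (y + t *: - nu) k.
  move=> uv yv d0 nud.
  have ap k : 0 < if k == m then 1 else lam v y k.
    by case: eqVneq => // km; rewrite yv facet_center_gt0.
  have [e e0 he] := affine_gt0_near0
    (fun k => if k == m then 0 else dotp (grad v k) (- nu)) ap.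
  exists e => // t te k; rewrite lamD dotpZr; have := he t te k.
  case: eqVneq => [->|] // _; rewrite yv facet_center0// add0r.
  rewrite nud -scaleN1r scalerA dotpZr mulN1r.
  have /andP[t0 _] := te.
  by rewrite !mulr_gt0 ?oppr_gt0// dotp_gt0// grad_neq0.
have [e e0 he] := inside w i c uw erefl c0 nuE.
have [e' e0' he'] := inside w' i' kappa uw' yE k0 nuE'.
pose t := Num.min e e' / 2.
have tP : 0 < t < e /\ 0 < t < e'.
  have m0 : 0 < Num.min e e' by rewrite lt_min e0.
  have [m1 m2] : Num.min e e' <= e /\ Num.min e e' <= e' by rewrite !ge_min !lexx orbT.
  by rewrite /t; split; lra.
have : (interior (conv_hull (range w)) `&` interior (conv_hull (range w'))) (y + t *: - nu).
  by split; apply: interior_simplex => // k; [apply: he tP.1 _|apply: he' tP.2 _].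
by rewrite disj.
Qed.

(** A short move towards the facet center stays in the open set and makes all other coordinates
    positive. *)
Lemma facet_relative_interior w i (D : set 'rV[R]_n.+1) x : edges w \in unitmx ->
  open D -> D x -> (forall k, 0 <= lam w x k) -> lam w x i = 0 ->
  exists y, [/\ D y, lam w y i = 0 & forall k, k != i -> 0 < lam w y k].
Proof.
move=> uw oD Dx x0 xi; pose c := facet_center w i.
have [e e0 he] := open_segment (c - x) oD Dx.
pose t := Num.min e 1 / 2.
have m0 : 0 < Num.min e 1 by rewrite lt_min e0/=.
have [m1 m2] : Num.min e 1 <= e /\ Num.min e 1 <= 1 by rewrite !ge_min !lexx orbT.
have [te t1] : 0 < t < e /\ t < 1 by rewrite /t; split; lra.
have lamE k : lam w (x + t *: (c - x)) k = t * lam w c k + (1 - t) * lam w x k.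
  rewrite lamD dotpZr dotp_grad_sub; ring.
exists (x + t *: (c - x)); split; first exact: he.
  by rewrite lamE xi facet_center0// !mulr0 addr0.
move=> k ki; rewrite lamE ltr_pwDl//; last by rewrite mulr_ge0// subr_ge0 ltW.
by rewrite mulr_gt0 ?facet_center_gt0//; case/andP: te.
Qed.

End FacetGeometry.

Section SurfaceIntegrals.
Variables (R : realType) (m n : nat).
Implicit Types (w : 'I_m.+1 -> 'rV[R]_n) (f g : 'rV[R]_n -> R).

Lemma surface_integralD w f g : polyfun f -> polyfun g ->
  surface_integral w (fun x => f x + g x) =
  surface_integral w f + surface_integral w g.
Proof.
move=> pf pg; rewrite !surface_integralE -mulrDr -ref_intD//; exact: polyfun_param.
Qed.

Lemma surface_integralZ w c f : polyfun f ->
  surface_integral w (fun x => c * f x) = c * surface_integral w f.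
Proof.
move=> pf; rewrite !surface_integralE mulrCA ref_intZ//; exact: polyfun_param.
Qed.

Lemma eq_surface_integral w f g : (forall s, f (param w s) = g (param w s)) ->
  surface_integral w f = surface_integral w g.
Proof.
by move=> fg; rewrite !surface_integralE; congr (_ * ref_int _); exact/funext.
Qed.

Lemma surface_integral_shift w v f :
  surface_integral (fun k => w k + v) f = surface_integral w (fun x => f (x + v)).
Proof.
have eE : edges (fun k => w k + v) = edges w.
  by apply/row_matrixP => i; rewrite !row_edges opprD addrACA subrr addr0.
rewrite !surface_integralE eE; congr (_ * ref_int _); apply/funext => s.
by rewrite /param eE addrAC.
Qed.

End SurfaceIntegrals.

(** * Cancellation of the fluxes through the faces *)

Section Flux.
Variables (R : realType) (d' : nat) (K : finType) (M : mesh R d' K).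
Hypothesis hM : is_mesh M.
Local Notation d := d'.+1.
Local Notation broken := (broken R d' K).
Local Notation faces := (K * 'I_d.+1)%type.
Implicit Types (f : faces) (u z : broken).

Let uvtx k : edges (vtx M k) \in unitmx := vtx_nondegenerate hM k.

Definition face_vertex f : 'I_d -> 'rV[R]_d := facet (vtx M f.1) f.2.

Lemma face_verticesE f : face_vertices M f = range (face_vertex f).
Proof. by rewrite range_lift. Qed.

Lemma face_vertex_inj f : injective (face_vertex f).
Proof. exact: facet_inj (uvtx f.1). Qed.

Lemma faceE f : face M f = simplex_face (vtx M f.1) [set i | i != f.2].
Proof. by rewrite -conv_hull_vertices. Qed.

Lemma broken_divergence u j : broken_integral M (bderiv j u) =
  \sum_(f : faces) surface_integral (face_vertex f) (pev (u f.1)) * Defs.normal M f 0 j.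
Proof.
rewrite /broken_integral -(pair_bigA _ (fun k i =>
  surface_integral (face_vertex (k, i)) (pev (u k)) * Defs.normal M (k, i) 0 j))/=.
by apply: eq_bigr => k _; rewrite ffunE -(divergence_simplex (uvtx k)).
Qed.

Definition flux u z j k f : R :=
  surface_integral (face_vertex f) (pev (bmul u (bderiv k z) f.1)) * Defs.normal M f 0 j -
  surface_integral (face_vertex f) (pev (bmul u (bderiv j z) f.1)) * Defs.normal M f 0 k.

Lemma bform_commutator u z j k :
  bform M (bderiv k z) (bderiv j u) - bform M (bderiv j z) (bderiv k u) =
  \sum_f flux u z j k f.
Proof.
rewrite sumrB -!broken_divergence -!(mulN1r (broken_integral _ _)).
rewrite -!(broken_integralZ hM) -!(broken_integralD hM).
congr broken_integral; apply/ffunP => l; rewrite !ffunE.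
rewrite !mpoly.mderivM (mpoly.mderiv_comm j k); rewrite !scaleN1r; ring.
Qed.

Definition tangent (nu : 'rV[R]_d) (j k : 'I_d) : 'rV[R]_d :=
  nu 0 j *: delta_mx 0 k - nu 0 k *: delta_mx 0 j.

Lemma dotp_tangent nu j k : dotp nu (tangent nu j k) = 0.
Proof. by rewrite dotpBr !dotpZr !dotp_delta mulrC subrr. Qed.

Lemma fluxE u z j k f : flux u z j k f =
  surface_integral (face_vertex f) (fun x =>
    pev (u f.1) x * dirderiv (tangent (Defs.normal M f) j k) (z f.1) x).
Proof.
rewrite /flux ![_ * Defs.normal _ _ _ _]mulrC -mulNr -!surface_integralZ; try exact: polyfun_pev.
rewrite -surface_integralD; try by apply: polyfunZ; exact: polyfun_pev.
apply: eq_surface_integral => s.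
rewrite /tangent dirderivD -scaleNr !dirderivZ !dirderiv_delta !ffunE !pevM; ring.
Qed.

(** Agreement on the whole hyperplane of the face, which contains full lines in tangential
    directions; [v] is the periodic shift, or 0 for an inner face. *)
Definition agree u f f' v := forall x, lam (vtx M f.1) x f.2 = 0 ->
  pev (u f.1) x = pev (u f'.1) (x + v).

Lemma flux_opposite u z j k f f' v :
  face_vertices M f' = [set x + v | x in face_vertices M f] ->
  Defs.normal M f' = - Defs.normal M f -> agree u f f' v -> agree z f f' v ->
  flux u z j k f' = - flux u z j k f.
Proof.
move=> fv nn au az; rewrite !fluxE.
have pf g : polyfun (fun x => pev (u g.1) x *
    dirderiv (tangent (Defs.normal M g) j k) (z g.1) x).
  by apply: polyfunM; [exact: polyfun_pev|exact: polyfun_dirderiv].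
rewrite (surface_integral_range (v := fun i => face_vertex f i + v) (pf f'));
  [|exact: face_vertex_inj| |]; last 2 first.
- by move=> a b /addIr/face_vertex_inj.
- rewrite -face_verticesE fv face_verticesE; apply/seteqP; split => x /=.
    by move=> [_ [i _ <-] <-]; exists i.
  by move=> [i _ <-]; exists (face_vertex f i) => //; exists i.
rewrite surface_integral_shift -mulN1r -surface_integralZ; last exact: pf.
apply: eq_surface_integral => s; set x := param _ _.
have x0 : lam (vtx M f.1) x f.2 = 0 by exact: lam_param_facet0.
rewrite -(au x x0) nn.
have -> : tangent (- Defs.normal M f) j k = -1 *: tangent (Defs.normal M f) j k.
  by rewrite /tangent !mxE scalerBr !scalerA !mulN1r.
rewrite dirderivZ.
have <- : dirderiv (tangent (Defs.normal M f) j k) (z f.1) x =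
    dirderiv (tangent (Defs.normal M f) j k) (z f'.1) (x + v).
  (* The tangent vector is orthogonal to the normal, hence to the gradient, so the line remains in
     the hyperplane of the face. *)
  apply: dirderiv_line_eq => t; apply: az; rewrite lamD x0 add0r dotpZr.
  have [c c0 nE] := @outward_normal_grad _ _ (vtx M f.1) f.2 (uvtx f.1).
  have := dotp_tangent (Defs.normal M f) j k; rewrite {1}/Defs.normal nE dotpZl.
  by move=> /eqP; rewrite mulf_eq0 lt_eqF//= => /eqP ->; rewrite mulr0.
by rewrite !mulN1r mulrN.
Qed.

(** The hypothesis concerns the [phi c] only, but the derivatives of [z] have degree at most [N] on
    each element and expand in them; both halves of the flux then vanish separately by linearity. *)
Lemma sum_boundary_flux N nc (phi : 'I_nc -> broken) u z j k :
  is_basis (DG N) phi -> DG N.+1 z ->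
  (forall c, boundary_integral M u (phi c) = 0) ->
  \sum_(f : faces | `[< on_frontier M f >] && (twin M f == f)) flux u z j k f = 0.
Proof.
move=> hphi hz hu.
have bd w i : DG N w ->
    \sum_(f : faces | `[< on_frontier M f >] && (twin M f == f))
      surface_integral (face_vertex f) (pev (bmul u w f.1)) * Defs.normal M f 0 i = 0.
  move=> hw; have [_ /(_ _ hw)[a [-> _]]] := hphi.
  transitivity (\sum_c a c * (boundary_integral M u (phi c)) 0 i); last first.
    by rewrite big1// => c _; rewrite hu mxE mulr0.
  rewrite (eq_bigr (fun f => \sum_c a c *
    (surface_integral (face_vertex f) (pev (bmul u (phi c) f.1)) * Defs.normal M f 0 i))).
    rewrite exchange_big; apply: eq_bigr => c _; rewrite -mulr_sumr summxE.
    congr (_ * _); apply: eq_bigr => f _; rewrite mxE; congr (_ * _).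
    by apply: eq_surface_integral => s; rewrite ffunE pevM.
  move=> f _; under [RHS]eq_bigr do rewrite mulrA.
  rewrite -mulr_suml; congr (_ * _).
  rewrite ffunE sum_ffunE mulr_sumr.
  elim/big_rec2 : _ => [|c y q _ <-].
    rewrite -[RHS](mul0r (surface_integral (face_vertex f) (pev 0))).
    rewrite -surface_integralZ; last exact: polyfun_pev.
    by apply: eq_surface_integral => s; rewrite mul0r [LHS]mpoly.meval0.
  rewrite -surface_integralZ; last exact: polyfun_pev.
  rewrite -surface_integralD; [|by apply: polyfunZ; exact: polyfun_pev|exact: polyfun_pev].
  by apply: eq_surface_integral => s; rewrite !ffunE -pevZ -pevD scalerAr.
by rewrite sumrB !bd ?subrr//; exact: bderiv_DG.
Qed.

End Flux.

(** * Inner faces and their partners *)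

Section Pairing.
Variables (R : realType) (d' : nat) (K : finType) (M : mesh R d' K).
Hypothesis hM : is_mesh M.
Local Notation d := d'.+1.
Local Notation broken := (broken R d' K).
Local Notation faces := (K * 'I_d.+1)%type.
Implicit Types (f : faces) (u z : broken).

Let uvtx k : edges (vtx M k) \in unitmx := vtx_nondegenerate hM k.

Lemma eltE k : elt M k = [set x | forall i, 0 <= lam (vtx M k) x i].
Proof. exact: conv_hull_range (uvtx k). Qed.

Lemma face_sub_elt f : face M f `<=` elt M f.1.
Proof. by rewrite eltE faceE// => x hx i; exact: (hx i).1. Qed.

(** The target [z] may lie outside the face, anywhere in its hyperplane. *)
Lemma face_segment f y (z : 'rV[R]_d) : lam (vtx M f.1) y f.2 = 0 ->
  (forall k, k != f.2 -> 0 < lam (vtx M f.1) y k) -> lam (vtx M f.1) z f.2 = 0 ->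
  exists2 e : R, 0 < e & forall t, 0 < t < e -> face M f (y + t *: (z - y)).
Proof.
set w := vtx M f.1 => y0 yp z0.
have ap k : 0 < if k == f.2 then 1 else lam w y k.
  by case: eqVneq => // km; exact: yp.
have [e e0 he] := affine_gt0_near0
  (fun k => if k == f.2 then 0 else dotp (grad w k) (z - y)) ap.
exists e => // t te; rewrite faceE// => k; rewrite -/w lamD dotpZr.
have := he t te k; case: eqVneq => [->|kf] h.
  by rewrite dotp_grad_sub z0 y0 subrr mulr0 addr0; split.
by split=> [|/(_ kf)//]; exact: ltW.
Qed.

Lemma face_center_spec f : exists y, lam (vtx M f.1) y f.2 = 0 /\
  forall k, k != f.2 -> 0 < lam (vtx M f.1) y k.
Proof.
exists (facet_center (vtx M f.1) f.2); split; first exact: facet_center0.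
by move=> k; exact: facet_center_gt0.
Qed.

Lemma inner_face_point f : ~ on_frontier M f -> exists y,
  [/\ Defs.dom M y, lam (vtx M f.1) y f.2 = 0 &
      forall k, k != f.2 -> 0 < lam (vtx M f.1) y k].
Proof.
move=> /existsNP[x /not_implyP[fx nx]].
have cx : closure (Defs.dom M) x.
  by rewrite (elt_cover hM); exists f.1 => //; exact: face_sub_elt.
(* A point of the closure that is not on the frontier is interior to the domain. *)
have dx : Defs.dom M x.
  by apply: interior_subset; apply: contrapT => nix; apply: nx.
have hx : simplex_face (vtx M f.1) [set i | i != f.2] x by rewrite -faceE.
apply: (facet_relative_interior (uvtx f.1) (dom_open hM) dx).
  by move=> k; exact: (hx k).1.
by apply: (hx f.2).2 => /=; rewrite eqxx.
Qed.

(** A segment issuing from a relatively interior point in the domain begins inside both the face and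
    the domain, where both traces equal the same function [g]; [pev_line_eq] does the rest. *)
Lemma agree_inner N u f f' : CG M N u -> face_vertices M f' = face_vertices M f ->
  ~ on_frontier M f -> agree M u f f' 0.
Proof.
move=> [_ [g [_ hg]] _] fv nf z z0.
have [y [dy y0 yp]] := inner_face_point nf.
have [e1 e10 h1] := face_segment y0 yp z0.
have [e2 e20 h2] := open_segment (z - y) (dom_open hM) dy.
have e0 : 0 < Num.min e1 e2 by rewrite lt_min e10.
apply: (@pev_line_eq _ _ _ _ _ y _ _ e0) => t; rewrite lt_min => /andP[t0 /andP[t1 t2]].
have fx : face M f (y + t *: (z - y)) by apply: h1; rewrite t0.
have dx : Defs.dom M (y + t *: (z - y)) by apply: h2; rewrite t0.
rewrite addr0 -[LHS]hg//; last exact: face_sub_elt.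
apply: hg => //; apply: (@face_sub_elt f').
by rewrite /face fv.
Qed.

Lemma agree_twin N u f : CG M N u -> twin M f != f ->
  agree M u f (twin M f) (Defs.shift M f).
Proof.
move=> [_ _ hu] tf z z0.
have [y [y0 yp]] := face_center_spec f.
have [e e0 he] := face_segment y0 yp z0.
apply: (@pev_line_eq _ _ _ _ _ y _ _ e0) => t te.
by rewrite [RHS]hu//; exact: he.
Qed.

(* Just outside the element, near a relatively interior point of the face, the
   domain is covered by the other elements; they are closed and finitely many. *)
Lemma neighbor_exists f : ~ on_frontier M f ->
  exists f', f' != f /\ face_vertices M f' = face_vertices M f.
Proof.
case: f => k i nf; have [y [dy /= y0 yp]] := inner_face_point nf.
have yk : elt M k y.
  rewrite eltE => j; have [->|ji] := eqVneq j i; first by rewrite y0.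
  exact/ltW/yp.
have [l [lk yl]] : exists l, l != k /\ elt M l y.
  apply: contrapT => /forallNP nl.
  (* Each other element misses [y] through some negative coordinate, which remains negative on a
     short move along [- g]; the same move leaves element [k], so the cover is contradicted. *)
  have /choice[j hj] : forall l, exists j, l != k -> lam (vtx M l) y j < 0.
    move=> l; have [->|lk] := eqVneq l k; first by exists ord0.
    have : ~ elt M l y by move=> yl; apply: (nl l).
    by rewrite eltE => /existsNP[j /negP]; rewrite -ltNge => hj; exists j.
  pose g := grad (vtx M k) i.
  pose a l := if l == k then 1 else - lam (vtx M l) y (j l).
  pose b l := if l == k then 0 else - dotp (grad (vtx M l) (j l)) (- g).
  have a0 l : 0 < a l by rewrite /a; case: eqVneq => // lk; rewrite oppr_gt0 hj.
  have [e1 e10 h1] := affine_gt0_near0 b a0.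
  have [e2 e20 h2] := open_segment (- g) (dom_open hM) dy.
  pose t := Num.min e1 e2 / 2.
  have m0 : 0 < Num.min e1 e2 by rewrite lt_min e10.
  have [m1 m2] : Num.min e1 e2 <= e1 /\ Num.min e1 e2 <= e2 by rewrite !ge_min !lexx orbT.
  have [t0 t1 t2] : [/\ 0 < t, 0 < t < e1 & 0 < t < e2] by rewrite /t; split; lra.
  have : closure (Defs.dom M) (y + t *: - g) by apply: subset_closure; exact: h2.
  rewrite (elt_cover hM) => -[l _]; rewrite eltE/=; have [->|lk] := eqVneq l k.
    move=> /(_ i); rewrite lamD y0 add0r -scaleN1r scalerA dotpZr mulrN1 mulNr oppr_ge0.
    by rewrite leNgt mulr_gt0// dotp_gt0// grad_neq0.
  move=> /(_ (j l)); have := h1 t t1 l; rewrite /a /b (negbTE lk) lamD dotpZr; lra.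
have cap : (elt M k `&` elt M l) y by [].
rewrite (elt_conformal hM) in cap.
pose P := [set j | range (vtx M l) (vtx M k j)].
have capE : range (vtx M k) `&` range (vtx M l) = [set vtx M k j | j in P].
  apply/seteqP; split => x; first by move=> [[j _ <-] h]; exists j.
  by move=> [j Pj <-]; split => //; exists j.
rewrite capE (conv_hull_vertices (uvtx k)) in cap.
(* By conformity [y] is in the hull of the common vertices, and its coordinates other than [i] are
   positive, so every vertex of the face is common. *)
have vl j : exists m, vtx M l m = vtx M k (lift i j).
  have /(_ (lift i j)) := yp; rewrite eq_sym neq_lift => /(_ isT) lp.
  suff [m _ <-] : P (lift i j) by exists m.
  by apply: contrapT => nP; move: lp; rewrite (cap _).2// ltxx.
have /choice[tau htau] := vl.
have tau_inj : injective tau.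
  by move=> a b ab; apply: (@lift_inj _ i); apply: (vertex_inj (uvtx k)); rewrite -!htau ab.
(* An element has one vertex more than a face; the vertex of [l] missed by [tau] is the one opposite
   to the common face. *)
have [i' hi'] : exists i', i' \notin codom tau.
  apply/existsP; rewrite -negb_forall; apply/negP => /forallP h.
  have : (#|'I_d.+1| <= #|codom tau|)%N by apply: subset_leq_card; apply/fintype.subsetP => m _; exact: h.
  by rewrite card_codom// !card_ord ltnn.
exists (l, i'); split; first by apply: contraNneq lk => -[->].
rewrite !face_verticesE; apply/seteqP; split => x.
  move=> [m _ <-]; rewrite /face_vertex /facet /=.
  have : lift i' m \in codom tau.
    have sub : codom tau \subset predC1 i'.
      by apply/fintype.subsetP => a ha; rewrite inE; apply: contraNneq hi' => <-.
    have card : #|codom tau| = #|predC1 i'| by rewrite card_codom// cardC1 !card_ord.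
    by rewrite (subset_cardP card sub) inE eq_sym neq_lift.
  by move=> /codomP[j ->]; exists j => //; rewrite htau.
move=> [j _ <-]; rewrite /face_vertex /facet /= -htau.
case: (unliftP i' (tau j)) => [m|] E; first by exists m => //=; rewrite E.
by move: hi'; rewrite -E codom_f.
Qed.

Lemma opposite_faces f f' : f' != f -> face_vertices M f' = face_vertices M f ->
  Defs.normal M f' = - Defs.normal M f.
Proof.
move=> ff fv; apply: opposite_normal => //.
  by have := esym fv; rewrite !face_verticesE.
(* Within one element the vertex set determines the face, so the two elements are distinct. *)
apply: (elt_disjoint hM); apply: contra_neq ff.
case: f f' fv => k i [k' i'] /= + kk; rewrite -{}kk => fv.
congr (_, _); apply: contrapT => ii.
have : face_vertices M (k, i) (vtx M k i') by exists i' => //=; apply/eqP.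
rewrite -fv => -[j /= ji /(vertex_inj (uvtx k)) E].
by move: ji; rewrite E eqxx.
Qed.

Definition partner f f' : Prop :=
  (twin M f != f /\ f' = twin M f) \/
  [/\ twin M f = f, ~ on_frontier M f, f' != f & face_vertices M f' = face_vertices M f].

Lemma partner_sym f f' : partner f f' -> partner f' f.
Proof.
case=> [[tf ->]|[tf nf ff fv]]; [left|right].
  by rewrite (twinK hM) eq_sym.
have nf' : ~ on_frontier M f' by rewrite /on_frontier /face fv.
split=> //; last by rewrite eq_sym.
(* If [f'] were identified with another face, it would lie on the frontier, and so would [f], which
   has the same vertices. *)
by apply: contrapT => /eqP tf'; apply: nf'; exact: (twin_frontier hM).
Qed.

(** Three distinct faces with the same vertices would have pairwise opposite normals, so a unit
    vector would be its own opposite. *)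
Lemma partner_unique f f1 f2 : partner f f1 -> partner f f2 -> f1 = f2.
Proof.
case=> [[tf ->]|[tf nf ff fv]]; case=> [[tf' ->]|[tf' nf' ff' fv']] //.
- by move: tf; rewrite tf' eqxx.
- by move: tf'; rewrite tf eqxx.
apply: contrapT => /eqP f12.
have := opposite_faces f12 (etrans fv (esym fv')).
rewrite (opposite_faces ff fv) (opposite_faces ff' fv') => /eqP.
rewrite opprK eq_sym -addr_eq0 -mulr2n -scaler_nat scaler_eq0 pnatr_eq0/= => /eqP n0.
have [+ _ _] := outward_normalP (uvtx f.1) f.2.
rewrite -[outward_normal _ _]/(Defs.normal M f) n0 -(scale0r (0 : 'rV_d)) dotpZl mul0r.
by move/eqP; rewrite eq_sym oner_eq0.
Qed.

Lemma partner_exists f : (exists f', partner f f') <->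
  ~~ (`[< on_frontier M f >] && (twin M f == f)).
Proof.
rewrite negb_and; split.
  by case=> f' [[-> _]|[_ nf _ _]]; rewrite ?orbT//; apply/orP; left; exact/asboolPn.
have [tf|tf _] := eqVneq (twin M f) f; last by exists (twin M f); left.
rewrite orbF => /asboolPn nf; have [f' [ff fv]] := neighbor_exists nf.
by exists f'; right.
Qed.

Lemma partner_flux N u z j k f f' : CG M N u -> CG M N z -> partner f f' ->
  flux M u z j k f' = - flux M u z j k f.
Proof.
move=> hu hz [[tf ->]|[tf nf ff fv]].
  apply: (@flux_opposite _ _ _ _ hM _ _ _ _ _ _ (Defs.shift M f)).
  - exact: twin_shift.
  - exact: twin_opposite.
  - exact: agree_twin hu tf.
  - exact: agree_twin hz tf.
apply: (@flux_opposite _ _ _ _ hM _ _ _ _ _ _ 0).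
- rewrite fv; apply/seteqP; split => x; first by move=> h; exists x => //; rewrite addr0.
  by move=> [a h <-]; rewrite addr0.
- exact: opposite_faces.
- exact: agree_inner hu fv nf.
- exact: agree_inner hz fv nf.
Qed.

(** Reindexing along the involution that exchanges partners turns the sum into its opposite. *)
Lemma sum_inner_flux N u z j k : CG M N u -> CG M N z ->
  \sum_(f : faces | ~~ (`[< on_frontier M f >] && (twin M f == f))) flux M u z j k f = 0.
Proof.
move=> hu hz; pose P f := ~~ (`[< on_frontier M f >] && (twin M f == f)).
rewrite -/(\sum_(f | P f) flux M u z j k f).
(* The identity on the remaining boundary faces makes [pi] an involution of all faces. *)
have /choice[pi hpi] : forall f, exists f', if P f then partner f f' else f' = f.
  by move=> f; case Pf: (P f); [exact/partner_exists|exists f].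
have Ppi f : P (pi f) = P f.
  have := hpi f; have [Pf h|/negbTE Pf ->//] := boolP (P f).
  by apply/partner_exists; exists f; exact: partner_sym.
have piK : involutive pi.
  move=> f; have := hpi (pi f); have := hpi f; rewrite Ppi.
  case: (P f) => [|-> //]; move=> /partner_sym h1 h2; exact: partner_unique h2 h1.
set S := \sum_(f | _) _.
have SN : S = - S.
  rewrite {1}/S (reindex_inj (inv_inj piK)) /S -sumrN; apply: eq_big => [f|f]; first exact: Ppi.
  rewrite -/(P (pi f)) Ppi => Pf; have := hpi f; rewrite Pf.
  exact: (partner_flux j k hu hz).
lra.
Qed.

Lemma bform_comm N nc (phi : 'I_nc -> broken) u z j k :
  is_basis (DG N) phi -> CG M N.+1 u -> CG M N.+1 z ->
  (forall c, boundary_integral M u (phi c) = 0) ->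
  bform M (bderiv k z) (bderiv j u) = bform M (bderiv j z) (bderiv k u).
Proof.
move=> hphi hu hz hb; apply/eqP; rewrite -subr_eq0 bform_commutator//; apply/eqP.
rewrite (bigID (fun f => `[< on_frontier M f >] && (twin M f == f)))/=.
rewrite (sum_boundary_flux j k hphi)//; last by case: hz.
by rewrite (sum_inner_flux j k hu hz) addr0.
Qed.

Lemma CG_sum N (I : Type) (r : seq I) (a : I -> R) (b : I -> broken) :
  (forall i, CG M N (b i)) -> CG M N (\sum_(i <- r) a i *: b i).
Proof.
move=> hb.
have pevE l x : pev ((\sum_(i <- r) a i *: b i) l) x = \sum_(i <- r) a i * pev (b i l) x.
  rewrite sum_ffunE; elim/big_rec2 : _ => [|i y q _ <-]; first exact: mpoly.meval0.
  by rewrite pevD ffunE pevZ.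
have /choice[g hg] : forall i, exists g : 'rV[R]_d -> R, {within Defs.dom M, continuous g} /\
    forall k x, Defs.dom M x -> elt M k x -> g x = peval (b i k) x.
  by move=> i; have [_ h _] := hb i.
split.
- by apply: DG_sum => i; have [] := hb i.
- exists (fun x => \sum_(i <- r) a i * g i x); split; last first.
    move=> k x dx kx; rewrite [RHS]pevE; apply: eq_bigr => i _.
    by congr (_ * _); exact: (hg i).2.
  elim: r {pevE} => [|i r IH].
    under eq_fun do rewrite big_nil; exact: cst_continuous.
  under eq_fun do rewrite big_cons.
  have gi : {within Defs.dom M, continuous g i} := (hg i).1.
  have ai : {within Defs.dom M, continuous fun=> a i} by exact: cst_continuous.
  move=> x; exact: (continuousD (continuousM (ai x) (gi x)) (IH x)).
- move=> f x tf fx; rewrite [LHS]pevE [RHS]pevE; apply: eq_bigr => i _.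
  by have [_ _ h] := hb i; congr (_ * _); exact: h.
Qed.

End Pairing.

Theorem lemma2p1 (R : realType) (d' : nat) (hd : d'.+1 = 2%N \/ d'.+1 = 3%N)
    (K : finType) (M : mesh R d' K) (hM : is_mesh M) (N : nat)
    (nc np : nat) (phi : 'I_nc -> broken R d' K) (psi : 'I_np -> broken R d' K)
    (hphi : DG_basis N phi) (hpsi : CG_nodal_basis M N.+1 psi)
    (Z : 'I_np -> R) (p : 'I_np)
    (hp : forall c : 'I_nc, boundary_integral M (psi p) (phi c) = 0)
    (j k : 'I_d'.+1) :
  \sum_(c < nc) \sum_(q < np)
    dual_nabla M phi psi j p c * primary_nabla M phi psi k c q * Z q =
  \sum_(c < nc) \sum_(q < np)
    dual_nabla M phi psi k p c * primary_nabla M phi psi j c q * Z q.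
Proof.
have [bphi _] := hphi; have [[cpsi _] _] := hpsi.
have dpsi q : DG N.+1 (psi q) by have [] := cpsi q.
have cZ : CG M N.+1 (\sum_q Z q *: psi q) by exact: CG_sum.
exact: etrans (nablas_bform hM bphi Z p j k dpsi)
  (etrans (congr1 -%R (bform_comm hM j k bphi (cpsi p) cZ hp))
    (esym (nablas_bform hM bphi Z p k j dpsi))).
Qed.
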